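(* Let $r,s,p,q$ be positive integers with $r\le p$ and $s\le q$. With $A$ the supermatrix of coordinates, $\tilde{\mathcal O}$ the localized superalgebra of functions, and $\tilde{\mathcal O}^{\mathrm{SL}(r|s)}$ its ring of invariants, all as defined in the context, the ring of invariants $\tilde{\mathcal O}^{\mathrm{SL}(r|s)}$ is generated (as a superalgebra over $\mathbf k$) by the super minors $$X_{i_1\cdots i_r|\hat\jmath_1\cdots\hat\jmath_s}:=\mathrm{Ber}\,A_{i_1\cdots i_r|\hat\jmath_1\cdots\hat\jmath_s},\qquad X^*_{i_1\cdots i_r|\hat\jmath_1\cdots\hat\jmath_s}:=\mathrm{Ber}^*A_{i_1\cdots i_r|\hat\jmath_1\cdots\hat\jmath_s}$$ and the fake super minors $$X_{i_1\cdots i_{k-1}\hat\lambda\, i_{k+1}\cdots i_r|\hat\jmath_1\cdots\hat\jmath_s}:=\mathrm{Ber}\,A_{i_1\cdots i_{k-1}\hat\lambda\, i_{k+1}\cdots i_r|\hat\jmath_1\cdots\hat\jmath_s},$$ $$X^*_{i_1\cdots i_r|\hat\jmath_1\cdots\hat\jmath_{l-1}\,m\,\hat\jmath_{l+1}\cdots\hat\jmath_s}:=\mathrm{Ber}^*A_{i_1\cdots i_r|\hat\jmath_1\cdots\hat\jmath_{l-1}\,m\,\hat\jmath_{l+1}\cdots\hat\jmath_s},$$ where $1\le i_1<\cdots<i_r\le p$, $\hat 1\le\hat\jmath_1<\cdots<\hat\jmath_s\le\hat q$, $1\le k\le r$, $1\le l\le s$, $\hat\lambda\in\{\hat 1,\dots,\hat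 q\}$ and $m\in\{1,\dots,p\}$.
   Context: Ground field: $\mathbf k=\mathbb R$ or $\mathbb C$. A commutative superalgebra is a $\mathbb Z_2$-graded associative unital $\mathbf k$-algebra $\mathcal A=\mathcal A_0\oplus\mathcal A_1$ with $ab=(-1)^{p(a)p(b)}ba$ for homogeneous $a,b$ of parities $p(a),p(b)$. Supermatrices: an even supermatrix of size $r|s\times p|q$ over $\mathcal A$ is a block matrix $\begin{pmatrix} B_1 & B_2 \\ B_3 & B_4 \end{pmatrix}$ with $B_1$ of size $r\times p$, $B_2$ of size $r\times q$, $B_3$ of size $s\times p$, $B_4$ of size $s\times q$, where $B_1,B_4$ have entries in $\mathcal A_0$ and $B_2,B_3$ have entries in $\mathcal A_1$. Even rows/columns are indexed by unhatted integers, odd ones by hatted integers. The first $p$ columns are even vectors (even entries on top, odd entries at the bottom); the last $q$ columns are odd vectors (odd entries on top, even entries at the bottom). The set of these matrices is $\mathrm M_{r|s\times p|q}(\mathcal A)$. A fake supermatrix of type I is obtained from an even supermatrix by placing an odd vector in one of the even column positions; a fake supermatrix of type II is obtained by placing an even vector in one of the odd column positions. Berezinians: for $B=\begin{pmatrix} B_1 & B_2 \\ B_3 & B_4 \end{pmatrix}$ of size $r|s\times r|s$: if $B$ is an even supermatrix or a fake supermatrix of type I with $B_4$ invertible, $\mathrm{Ber}\,B:=\det(B_4)^{-1}\det(B_1-B_2B_4^{-1}B_3)$; if $B$ is an even supermatrix or a fake supermatrix of type II with $B_1$ invertible, $\mathrm{Ber}^*B:=\mathrm{Ber}\begin{pmatrix}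 B_4 & B_3 \\ B_2 & B_1 \end{pmatrix}=\det(B_1)^{-1}\det(B_4-B_3B_1^{-1}B_2)$. (In the fake cases the matrix whose determinant is taken has exactly one column with odd entries, so its determinant is unambiguous.) Functions: $\mathcal O=\mathbf k[x_{ij},y_{\hat k\hat l},\alpha_{i\hat l},\beta_{\hat k j}]$ is the free commutative superalgebra with even generators $x_{ij}$ ($1\le i\le r$, $1\le j\le p$), $y_{\hat k\hat l}$ ($1\le k\le s$, $1\le l\le q$) and odd generators $\alpha_{i\hat l}$, $\beta_{\hat kj}$ (same ranges), arranged in the even supermatrix $A=\begin{pmatrix} [x_{ij}] & [\alpha_{i\hat l}] \\ {[\beta_{\hat kj}]} & [y_{\hat k\hat l}] \end{pmatrix}$ of size $r|s\times p|q$. $A_{i_1\cdots i_r|\hat\jmath_1\cdots\hat\jmath_s}$ is the $r|s\times r|s$ supermatrix formed by columns $i_1,\dots,i_r$ (in the even positions) and $\hat\jmath_1,\dots,\hat\jmath_s$ (in the odd positions) of $A$, in this order; $A_{i_1\cdots i_{k-1}\hat\lambda i_{k+1}\cdots i_r|\hat\jmath_1\cdots\hat\jmath_s}$ is the fake supermatrix of type I obtained by putting the odd column $\hat\lambda$ of $A$ in the $k$-th even position, and $A_{i_1\cdots i_r|\hat\jmath_1\cdots\hat\jmath_{l-1}m\hat\jmath_{l+1}\cdots\hat\jmath_s}$ is the fake supermatrix of type II obtained by putting the even column $m$ of $A$ in the $l$-th odd position. Localization: $D_{i_1\cdots i_r}:=\det(x_{a i_b})_{1\le a,b\le r}$ and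 $D_{\hat\jmath_1\cdots\hat\jmath_s}:=\det(y_{\hat a\hat\jmath_b})_{1\le a,b\le s}$; $\tilde{\mathcal O}:=\mathcal O[D_{i_1\cdots i_r}^{-1},D_{\hat\jmath_1\cdots\hat\jmath_s}^{-1}]$, where all such determinants with strictly increasing indices are inverted. $\tilde{\mathrm M}_{r|s\times p|q}(\mathcal A)\subset\mathrm M_{r|s\times p|q}(\mathcal A)$ is the subset of supermatrices for which all these minors of the diagonal blocks are invertible in $\mathcal A$. For $f\in\tilde{\mathcal O}$ and $M\in\tilde{\mathrm M}_{r|s\times p|q}(\mathcal A)$, $f(M)\in\mathcal A$ denotes the value obtained by substituting the entries of $M$ for the generators. Action and invariants: $\mathrm{SL}(r|s)(\mathcal A)$ is the group of invertible even supermatrices of size $r|s\times r|s$ over $\mathcal A$ with Berezinian $1$. It acts on supermatrices by left multiplication $M\mapsto gM$, and on functions by $(f.g)(M):=f(gM)$. $\tilde{\mathcal O}^{\mathrm{SL}(r|s)}$ is the set of $f\in\tilde{\mathcal O}$ such that $f(gM)=f(M)$ for every commutative superalgebra $\mathcal A$, every $g\in\mathrm{SL}(r|s)(\mathcal A)$ and every $M\in\tilde{\mathrm M}_{r|s\times p|q}(\mathcal A)$. *)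

(* Defs.v *)
From HB Require Import structures.
From mathcomp Require Import all_boot all_order all_algebra fingroup perm.
From mathcomp Require Import generic_quotient.
From mathcomp Require Import boolp classical_sets reals.
From mathcomp.real_closed Require Export complex.

Set Implicit Arguments.
Unset Strict Implicit.
Unset Printing Implicit Defensive.

Import GRing.Theory Num.Theory.

Local Open Scope classical_set_scope.
Local Open Scope quotient_scope.
Local Open Scope ring_scope.

(* Parities are booleans: [false] is even and [true] is odd.  The carrier is an
   [algType], so the zero algebra is excluded. *)
Record superalg (k : numFieldType) := SuperAlg {
  salg_sort :> algType k;
  grade : bool -> set salg_sort;
  grade0 : forall b, grade b 0;
  gradeD : forall b x y, grade b x -> grade b y -> grade b (x + y);
  gradeZ : forall b (c : k) x, grade b x -> grade b (c *: x);
  grade_decomp : forall x,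
    exists x0 x1, [/\ grade false x0, grade true x1 & x = x0 + x1];
  grade_disj : forall x, grade false x -> grade true x -> x = 0;
  grade1 : grade false 1;
  gradeM : forall b c x y, grade b x -> grade c y -> grade (b (+) c) (x * y);
  supercomm : forall b c x y, grade b x -> grade c y ->
    x * y = (-1) ^+ (b && c) * (y * x) }.

Arguments grade {k} s b _.

Definition subsuperalg (k : numFieldType) (A : superalg k) (S : set A) : Prop :=
  [/\ S 1,
      forall x y, S x -> S y -> S (x + y),
      forall (c : k) x, S x -> S (c *: x),
      forall x y, S x -> S y -> S (x * y)
    & forall x0 x1, grade A false x0 -> grade A true x1 ->
        S (x0 + x1) -> S x0 /\ S x1].

Definition generated_superalg (k : numFieldType) (A : superalg k) (G : set A) :
  set A := smallest (@subsuperalg k A) G.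

(* The entries of the matrices live in a noncommutative ring, so [invmx] and the
   inverse of [unitRingType] are not available; inverses are chosen
   classically, with the junk value 0 when there is none. *)
Section Inverses.
Variable A : pzRingType.

Definition is_inverse (x y : A) : Prop := x * y = 1 /\ y * x = 1.
Definition invertible (x : A) : Prop := exists y, is_inverse x y.
End Inverses.

Definition inverse (A : nzRingType) (x : A) : A := xget 0 [set y | is_inverse x y].

Definition inverse_mx (A : nzRingType) n (B : 'M[A]_n) : 'M[A]_n :=
  xget 0 [set C : 'M[A]_n | B *m C = 1%:M /\ C *m B = 1%:M].

Section Supermatrices.
Variables (k : numFieldType) (A : superalg k).

Definition even_supermx r s p q (M : 'M[A]_(r + s, p + q)) : Prop :=
  [/\ forall i j, grade A false (ulsubmx M i j),
      forall i j, grade A true (ursubmx M i j),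
      forall i j, grade A true (dlsubmx M i j)
    & forall i j, grade A false (drsubmx M i j)].

(* [\det] is the Leibniz sum with each product taken in row order; in all uses
   below at most one column has odd entries, so the order does not matter. *)
Definition Ber r s (B : 'M[A]_(r + s)) : A :=
  inverse (\det (drsubmx B)) *
  \det (ulsubmx B - ursubmx B *m inverse_mx (drsubmx B) *m dlsubmx B).

Definition Berstar r s (B : 'M[A]_(r + s)) : A :=
  Ber (block_mx (drsubmx B) (dlsubmx B) (ursubmx B) (ulsubmx B)).

Definition SL r s : set 'M[A]_(r + s) :=
  [set g | [/\ even_supermx g,
      exists h : 'M[A]_(r + s),
        [/\ even_supermx h, g *m h = 1%:M & h *m g = 1%:M]
    & Ber g = 1]].

End Supermatrices.

Definition increasing r p :=
  {I : {ffun 'I_r -> 'I_p} |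
    [forall a : 'I_r, forall b : 'I_r, (a < b)%N ==> (I a < I b)%N]}.

Definition Mtilde (k : numFieldType) (A : superalg k) r s p q :
    set 'M[A]_(r + s, p + q) :=
  [set M | [/\ even_supermx M,
      forall I : increasing r p, invertible (\det (colsub (sval I) (ulsubmx M)))
    & forall J : increasing s q, invertible (\det (colsub (sval J) (drsubmx M)))]].

(* The localized superalgebra of functions is given by generators and relations:
   formal expressions in the coordinates and in the inverses of the minors of the
   diagonal blocks, modulo the congruence [fteq]. *)
Section Functions.
Variables (k : numFieldType) (r s p q : nat).

Inductive fgen :=
| GenX of 'I_r & 'I_p
| GenY of 'I_s & 'I_q
| GenAlpha of 'I_r & 'I_q
| GenBeta of 'I_s & 'I_p
| GenInvX of increasing r p
| GenInvY of increasing s q.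

Definition fpar (g : fgen) : bool :=
  match g with GenAlpha _ _ | GenBeta _ _ => true | _ => false end.

Inductive fterm :=
| FGen of fgen
| FZero
| FOne
| FOpp of fterm
| FAdd of fterm & fterm
| FMul of fterm & fterm
| FScale of k & fterm.

Definition fdet n (X : 'I_n -> 'I_n -> fterm) : fterm :=
  \big[FAdd/FZero]_(w : 'S_n)
     FScale ((-1) ^+ w) (\big[FMul/FOne]_(i < n) X i (w i)).

Definition fdetX (I : increasing r p) : fterm :=
  fdet (fun a b => FGen (GenX a (sval I b))).
Definition fdetY (J : increasing s q) : fterm :=
  fdet (fun a b => FGen (GenY a (sval J b))).

Inductive fteq : fterm -> fterm -> Prop :=
| fteq_refl t : fteq t t
| fteq_sym t u : fteq t u -> fteq u t
| fteq_trans t u v : fteq t u -> fteq u v -> fteq t v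
| fteq_opp t t' : fteq t t' -> fteq (FOpp t) (FOpp t')
| fteq_add t t' u u' : fteq t t' -> fteq u u' -> fteq (FAdd t u) (FAdd t' u')
| fteq_mul t t' u u' : fteq t t' -> fteq u u' -> fteq (FMul t u) (FMul t' u')
| fteq_scale c t t' : fteq t t' -> fteq (FScale c t) (FScale c t')
| fteq_addA t u v : fteq (FAdd t (FAdd u v)) (FAdd (FAdd t u) v)
| fteq_addC t u : fteq (FAdd t u) (FAdd u t)
| fteq_add0 t : fteq (FAdd FZero t) t
| fteq_addN t : fteq (FAdd (FOpp t) t) FZero
| fteq_mulA t u v : fteq (FMul t (FMul u v)) (FMul (FMul t u) v)
| fteq_mul1l t : fteq (FMul FOne t) t
| fteq_mul1r t : fteq (FMul t FOne) t
| fteq_mulDl t u v : fteq (FMul (FAdd t u) v) (FAdd (FMul t v) (FMul u v))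
| fteq_mulDr t u v : fteq (FMul t (FAdd u v)) (FAdd (FMul t u) (FMul t v))
| fteq_scaleA c d t : fteq (FScale c (FScale d t)) (FScale (c * d) t)
| fteq_scale1 t : fteq (FScale 1 t) t
| fteq_scaleDr c t u : fteq (FScale c (FAdd t u)) (FAdd (FScale c t) (FScale c u))
| fteq_scaleDl c d t : fteq (FScale (c + d) t) (FAdd (FScale c t) (FScale d t))
| fteq_scaleAl c t u : fteq (FScale c (FMul t u)) (FMul (FScale c t) u)
| fteq_scaleAr c t u : fteq (FScale c (FMul t u)) (FMul t (FScale c u))
| fteq_comm g h : fteq (FMul (FGen g) (FGen h))
    (FScale ((-1) ^+ (fpar g && fpar h)) (FMul (FGen h) (FGen g)))
| fteq_invX I : fteq (FMul (fdetX I) (FGen (GenInvX I))) FOne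
| fteq_invY J : fteq (FMul (fdetY J) (FGen (GenInvY J))) FOne.

Section Evaluation.
Variables (A : superalg k) (M : 'M[A]_(r + s, p + q)).

Definition feval_gen (g : fgen) : A :=
  match g with
  | GenX i j => ulsubmx M i j
  | GenY i j => drsubmx M i j
  | GenAlpha i j => ursubmx M i j
  | GenBeta i j => dlsubmx M i j
  | GenInvX K => inverse (\det (colsub (sval K) (ulsubmx M)))
  | GenInvY K => inverse (\det (colsub (sval K) (drsubmx M)))
  end.

Fixpoint feval (t : fterm) : A :=
  match t with
  | FGen g => feval_gen g
  | FZero => 0
  | FOne => 1
  | FOpp t => - feval t
  | FAdd t u => feval t + feval u
  | FMul t u => feval t * feval u
  | FScale c t => c *: feval t
  end.

Lemma inverseP (x : A) : invertible x -> is_inverse x (inverse x).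
Proof. by move=> [y xy]; rewrite /inverse; case: xgetP => [z -> //|/(_ y)]. Qed.

Lemma grade_inverse (x : A) :
  grade A false x -> invertible x -> grade A false (inverse x).
Proof.
move=> x_ev /inverseP[xy yx]; set y := inverse x in xy yx *.
have [y0 [y1 [ev0 od1 yE]]] := grade_decomp y.
have od : grade A true (x * y1) by apply: (gradeM (b := false) (c := true)).
have ev : grade A false (x * y1).
  have -> : x * y1 = 1 + (-1) *: (x * y0).
    by rewrite scaleN1r; apply/eqP; rewrite eq_sym subr_eq addrC -mulrDr -yE xy.
  apply: gradeD; first exact: grade1.
  by apply: gradeZ; apply: (gradeM (b := false) (c := false)).
have xy1 := grade_disj ev od.
have y10 : y1 = 0 by rewrite -[y1]mul1r -yx -mulrA xy1 mulr0.
by rewrite yE y10 addr0.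
Qed.

Lemma grade_det n (B : 'M[A]_n) :
  (forall i j, grade A false (B i j)) -> grade A false (\det B).
Proof.
move=> ev; apply: (big_ind (grade A false)) => [|x y|w _].
- exact: grade0.
- exact: gradeD.
rewrite mulr_sign -scaler_sign; apply: gradeZ.
apply: (big_ind (grade A false)) => [|x y|i _]; [exact: grade1| |exact: ev].
exact: (gradeM (b := false) (c := false)).
Qed.

Lemma feval_det n (X : 'I_n -> 'I_n -> fterm) :
  feval (fdet X) = \det (\matrix_(i, j) feval (X i j)).
Proof.
rewrite /fdet (big_morph feval (id1 := 0) (op1 := +%R)) //.
apply: eq_bigr => w _ /=; rewrite scaler_sign mulr_sign.
rewrite (big_morph feval (id1 := 1) (op1 := *%R)) //.
by under [in RHS]eq_bigr do rewrite mxE.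
Qed.

Lemma feval_fteq t u : Mtilde M -> fteq t u -> feval t = feval u.
Proof.
move=> [Mev MI MJ].
have evX (I : increasing r p) : grade A false (\det (colsub (sval I) (ulsubmx M))).
  by apply: grade_det => i j; rewrite mxE; case: Mev.
have evY (J : increasing s q) : grade A false (\det (colsub (sval J) (drsubmx M))).
  by apply: grade_det => i j; rewrite mxE; case: Mev.
elim=> {t u} //=.
- by move=> t u v _ -> _ ->.
- by move=> t t' _ ->.
- by move=> t t' u u' _ -> _ ->.
- by move=> t t' u u' _ -> _ ->.
- by move=> c t t' _ ->.
- by move=> *; rewrite addrA.
- by move=> *; rewrite addrC.
- by move=> *; rewrite add0r.
- by move=> *; rewrite addNr.
- by move=> *; rewrite mulrA.
- by move=> *; rewrite mul1r.
- by move=> *; rewrite mulr1.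
- by move=> *; rewrite mulrDl.
- by move=> *; rewrite mulrDr.
- by move=> *; rewrite scalerA.
- by move=> *; rewrite scale1r.
- by move=> *; rewrite scalerDr.
- by move=> *; rewrite scalerDl.
- by move=> *; rewrite scalerAl.
- by move=> *; rewrite scalerAr.
- have par g : grade A (fpar g) (feval_gen g).
    case: Mev => Mev1 Mev2 Mev3 Mev4.
    by case: g => //= *; apply: grade_inverse.
  by move=> g h; rewrite (supercomm (par g) (par h)) scaler_sign mulr_sign.
- move=> I; rewrite -[RHS](inverseP (MI I)).1 feval_det; congr (\det _ * _).
- move=> J; rewrite -[RHS](inverseP (MJ J)).1 feval_det; congr (\det _ * _).
Qed.

End Evaluation.

HB.instance Definition _ := gen_eqMixin fterm.
HB.instance Definition _ := gen_choiceMixin fterm.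

Definition fteqb (t u : fterm) : bool := `[< fteq t u >].

Lemma fteqb_refl : reflexive fteqb.
Proof. by move=> t; apply/asboolP/fteq_refl. Qed.
Lemma fteqb_sym : symmetric fteqb.
Proof. by move=> t u; apply/asboolP/asboolP => /fteq_sym. Qed.
Lemma fteqb_trans : transitive fteqb.
Proof.
by move=> u t v /asboolP tu /asboolP uv; apply/asboolP/(fteq_trans tu uv).
Qed.
Canonical fteq_equiv := EquivRel fteqb fteqb_refl fteqb_sym fteqb_trans.

Definition Ofun := {eq_quot fteq_equiv}.
HB.instance Definition _ := Choice.on Ofun.
HB.instance Definition _ := EqQuotient.on Ofun.

Definition Opi (t : fterm) : Ofun := \pi_Ofun t.

Lemma OpiP t u : Opi t = Opi u <-> fteq t u.
Proof.
by split=> [/eqP|tu]; [rewrite eqmodE => /asboolP|apply/eqP; rewrite eqmodE; apply/asboolP].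
Qed.

Lemma Opi_repr (f : Ofun) : Opi (repr f) = f.
Proof. exact: reprK. Qed.

Lemma repr_Opi t : fteq (repr (Opi t)) t.
Proof. by apply/OpiP; rewrite Opi_repr. Qed.

Lemma Ofun_ind (P : Ofun -> Prop) : (forall t, P (Opi t)) -> forall f, P f.
Proof. by move=> Pt f; rewrite -(Opi_repr f). Qed.

Definition Oopp (f : Ofun) : Ofun := Opi (FOpp (repr f)).
Definition Oadd (f g : Ofun) : Ofun := Opi (FAdd (repr f) (repr g)).
Definition Omul (f g : Ofun) : Ofun := Opi (FMul (repr f) (repr g)).
Definition Oscale (c : k) (f : Ofun) : Ofun := Opi (FScale c (repr f)).

Lemma Opi_opp t : Oopp (Opi t) = Opi (FOpp t).
Proof. by apply/OpiP/fteq_opp/repr_Opi. Qed.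
Lemma Opi_add t u : Oadd (Opi t) (Opi u) = Opi (FAdd t u).
Proof. by apply/OpiP/fteq_add; apply: repr_Opi. Qed.
Lemma Opi_mul t u : Omul (Opi t) (Opi u) = Opi (FMul t u).
Proof. by apply/OpiP/fteq_mul; apply: repr_Opi. Qed.
Lemma Opi_scale c t : Oscale c (Opi t) = Opi (FScale c t).
Proof. by apply/OpiP/fteq_scale/repr_Opi. Qed.

Definition OpiE := (Opi_opp, Opi_add, Opi_mul, Opi_scale).

Lemma OaddA : associative Oadd.
Proof. by do 3![elim/Ofun_ind=> ?]; rewrite !OpiE; apply/OpiP/fteq_addA. Qed.
Lemma OaddC : commutative Oadd.
Proof. by do 2![elim/Ofun_ind=> ?]; rewrite !OpiE; apply/OpiP/fteq_addC. Qed.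
Lemma Oadd0 : left_id (Opi FZero) Oadd.
Proof. by elim/Ofun_ind=> ?; rewrite !OpiE; apply/OpiP/fteq_add0. Qed.
Lemma OaddN : left_inverse (Opi FZero) Oopp Oadd.
Proof. by elim/Ofun_ind=> ?; rewrite !OpiE; apply/OpiP/fteq_addN. Qed.
Lemma OmulA : associative Omul.
Proof. by do 3![elim/Ofun_ind=> ?]; rewrite !OpiE; apply/OpiP/fteq_mulA. Qed.
Lemma Omul1l : left_id (Opi FOne) Omul.
Proof. by elim/Ofun_ind=> ?; rewrite !OpiE; apply/OpiP/fteq_mul1l. Qed.
Lemma Omul1r : right_id (Opi FOne) Omul.
Proof. by elim/Ofun_ind=> ?; rewrite !OpiE; apply/OpiP/fteq_mul1r. Qed.
Lemma OmulDl : left_distributive Omul Oadd.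
Proof. by do 3![elim/Ofun_ind=> ?]; rewrite !OpiE; apply/OpiP/fteq_mulDl. Qed.
Lemma OmulDr : right_distributive Omul Oadd.
Proof. by do 3![elim/Ofun_ind=> ?]; rewrite !OpiE; apply/OpiP/fteq_mulDr. Qed.
Lemma OscaleA c d f : Oscale c (Oscale d f) = Oscale (c * d) f.
Proof. by elim/Ofun_ind: f => ?; rewrite !OpiE; apply/OpiP/fteq_scaleA. Qed.
Lemma Oscale1 : left_id 1 Oscale.
Proof. by elim/Ofun_ind=> ?; rewrite !OpiE; apply/OpiP/fteq_scale1. Qed.
Lemma OscaleDr : right_distributive Oscale Oadd.
Proof. by move=> c; do 2![elim/Ofun_ind=> ?]; rewrite !OpiE; apply/OpiP/fteq_scaleDr. Qed.
Lemma OscaleDl f : {morph Oscale^~ f : c d / c + d >-> Oadd c d}.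
Proof. by elim/Ofun_ind: f => ? c d; rewrite !OpiE; apply/OpiP/fteq_scaleDl. Qed.
Lemma OscaleAl c f g : Oscale c (Omul f g) = Omul (Oscale c f) g.
Proof.
by elim/Ofun_ind: f => ?; elim/Ofun_ind: g => ?; rewrite !OpiE; apply/OpiP/fteq_scaleAl.
Qed.
Lemma OscaleAr c f g : Oscale c (Omul f g) = Omul f (Oscale c g).
Proof.
by elim/Ofun_ind: f => ?; elim/Ofun_ind: g => ?; rewrite !OpiE; apply/OpiP/fteq_scaleAr.
Qed.

End Functions.

Arguments feval {k r s p q A} M t.

(* The presentation is consistent: [k], concentrated in even degree, has points
   in [Mtilde], for instance those with Vandermonde diagonal blocks. *)
Section Nontrivial.
Variable k : numFieldType.

Definition kgrade (b : bool) : set k := if b then [set 0] else setT.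

Definition ground_superalg : superalg k.
Proof.
refine (@SuperAlg k (GRing.regular k) kgrade _ _ _ _ _ _ _ _).
- by case.
- by case=> //= x y -> ->; rewrite addr0.
- by case=> //= c x ->; rewrite scaler0.
- by move=> x; exists x, 0; split => //; rewrite addr0.
- by [].
- by [].
- by do 2![case] => //= x y; rewrite /= => *; subst; rewrite ?mulr0 ?mul0r.
- by do 2![case] => //= x y; rewrite /= => *; subst; rewrite ?mulr0 ?mul0r ?mul1r // ?mulr0 // mulrC.
Defined.

Definition vandermonde_block (n m : nat) : 'M[ground_superalg]_(n, m) :=
  \matrix_(i, j) (j%:R ^+ i : k).

Lemma vandermonde_invertible n m (I : increasing n m) :
  invertible (\det (colsub (sval I) (vandermonde_block n m))).
Proof.
suff nz : \det (colsub (sval I) (vandermonde_block n m) : 'M[k]_n) != 0.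
  by eexists (_^-1 : k); split; [apply: mulfV nz|apply: mulVf nz].
have -> : colsub (sval I) (vandermonde_block n m) =
    Vandermonde n (\row_j (sval I j)%:R : 'rV[k]_n).
  by apply/matrixP => i j; rewrite !mxE.
rewrite det_Vandermonde; apply/prodf_neq0 => i _; apply/prodf_neq0 => j ij.
rewrite !mxE subr_eq0 eqr_nat gtn_eqF //.
by have /forallP/(_ i)/forallP/(_ j)/implyP/(_ ij) := svalP I.
Qed.

Lemma vandermonde_Mtilde r s p q :
  Mtilde (block_mx (vandermonde_block r p) 0 0 (vandermonde_block s q)).
Proof.
split.
- by split=> i j //; rewrite ?block_mxKur ?block_mxKdl mxE.
- by move=> I; rewrite block_mxKul; apply: vandermonde_invertible.
- by move=> J; rewrite block_mxKdr; apply: vandermonde_invertible.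
Qed.

Lemma fteq_one_zero r s p q : ~ fteq (FOne k r s p q) (FZero k r s p q).
Proof.
move=> /(feval_fteq (vandermonde_Mtilde r s p q)) /= /eqP.
by apply/negP; apply: oner_neq0.
Qed.

End Nontrivial.

Section FunctionAlgebra.
Variables (k : numFieldType) (r s p q : nat).

Local Notation O := (Ofun k r s p q).

Lemma Oone_neq0 : Opi (FOne k r s p q) != Opi (FZero k r s p q).
Proof. by apply/eqP => /OpiP /fteq_one_zero. Qed.

HB.instance Definition _ := GRing.isZmodule.Build O
  (@OaddA k r s p q) (@OaddC k r s p q) (@Oadd0 k r s p q) (@OaddN k r s p q).
HB.instance Definition _ := GRing.Zmodule_isNzRing.Build O
  (@OmulA k r s p q) (@Omul1l k r s p q) (@Omul1r k r s p q)
  (@OmulDl k r s p q) (@OmulDr k r s p q) Oone_neq0.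
HB.instance Definition _ := GRing.Zmodule_isLmodule.Build k O
  (@OscaleA k r s p q) (@Oscale1 k r s p q) (@OscaleDr k r s p q)
  (@OscaleDl k r s p q).
HB.instance Definition _ := GRing.Lmodule_isLalgebra.Build k O
  (@OscaleAl k r s p q).
HB.instance Definition _ := GRing.Lalgebra_isAlgebra.Build k O
  (@OscaleAr k r s p q).

Definition Ogen (g : fgen r s p q) : O := Opi (FGen k g).

Inductive Ograde : bool -> set O :=
| Ograde_gen g : Ograde (fpar g) (Ogen g)
| Ograde0 b : Ograde b 0
| Ograde1 : Ograde false 1
| OgradeD b x y : Ograde b x -> Ograde b y -> Ograde b (x + y)
| OgradeZ b c x : Ograde b x -> Ograde b (c *: x)
| OgradeM b c x y : Ograde b x -> Ograde c y -> Ograde (b (+) c) (x * y).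

Lemma Opi0 : Opi (FZero k r s p q) = 0. Proof. by []. Qed.
Lemma Opi1 : Opi (FOne k r s p q) = 1. Proof. by []. Qed.
Lemma OpiN (t : fterm k r s p q) : Opi (FOpp t) = - Opi t.
Proof. by rewrite -Opi_opp. Qed.
Lemma OpiD (t u : fterm k r s p q) : Opi (FAdd t u) = Opi t + Opi u.
Proof. by rewrite -Opi_add. Qed.
Lemma OpiM (t u : fterm k r s p q) : Opi (FMul t u) = Opi t * Opi u.
Proof. by rewrite -Opi_mul. Qed.
Lemma OpiZ c (t : fterm k r s p q) : Opi (FScale c t) = c *: Opi t.
Proof. by rewrite -Opi_scale. Qed.

Lemma Ograde_decomp (x : O) :
  exists x0 x1, [/\ Ograde false x0, Ograde true x1 & x = x0 + x1].
Proof.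
elim/Ofun_ind: x; elim=> [g|||t [a [b [ea ob e]]]
    |t [a [b [ea ob e]]] u [c [d [ec od e']]]
    |t [a [b [ea ob e]]] u [c [d [ec od e']]]|z t [a [b [ea ob e]]]].
- have := Ograde_gen g; rewrite -/(Ogen g); case: (fpar g) => G.
    by exists 0, (Ogen g); split; rewrite ?add0r //; constructor.
  by exists (Ogen g), 0; split; rewrite ?addr0 //; constructor.
- by exists 0, 0; split; rewrite ?addr0 //; constructor.
- by exists 1, 0; split; rewrite ?addr0 //; constructor.
- exists ((-1) *: a), ((-1) *: b); split; try by constructor.
  by rewrite OpiN e -scalerDr scaleN1r.
- exists (a + c), (b + d); split; try by constructor.
  by rewrite OpiD e e' addrACA.
- exists (a * c + b * d), (a * d + b * c); split.
  + by apply: OgradeD; [apply: (OgradeM ea ec)|apply: (OgradeM ob od)].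
  + by apply: OgradeD; [apply: (OgradeM ea od)|apply: (OgradeM ob ec)].
  + by rewrite OpiM e e' mulrDl !mulrDr [b * c + b * d]addrC addrACA.
- exists (z *: a), (z *: b); split; try by constructor.
  by rewrite OpiZ e scalerDr.
Qed.

(* Even and odd components of an expression, used to see that the two graded
   parts of [O] meet in 0 *)
Fixpoint hpart (t : fterm k r s p q) : O * O :=
  match t with
  | FGen g => if fpar g then (0, Ogen g) else (Ogen g, 0)
  | FZero => (0, 0)
  | FOne => (1, 0)
  | FOpp t => (- (hpart t).1, - (hpart t).2)
  | FAdd t u => ((hpart t).1 + (hpart u).1, (hpart t).2 + (hpart u).2)
  | FMul t u => ((hpart t).1 * (hpart u).1 + (hpart t).2 * (hpart u).2,
                 (hpart t).1 * (hpart u).2 + (hpart t).2 * (hpart u).1)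
  | FScale c t => (c *: (hpart t).1, c *: (hpart t).2)
  end.

Lemma hpart_det n (X : 'I_n -> 'I_n -> fgen r s p q) :
  (forall i j, fpar (X i j) = false) ->
  hpart (fdet (fun i j => FGen k (X i j))) =
    (Opi (fdet (fun i j => FGen k (X i j))), 0).
Proof.
move=> ev; rewrite /fdet.
apply: (big_ind (fun t => hpart t = (Opi t, 0))) => //=.
  by move=> t u -> -> /=; rewrite OpiD addr0.
move=> w _; rewrite OpiZ.
suff -> : hpart (\big[@FMul k r s p q/FOne k r s p q]_i FGen k (X i (w i))) =
    (Opi (\big[@FMul k r s p q/FOne k r s p q]_i FGen k (X i (w i))), 0).
  by rewrite /= scaler0.
apply: (big_ind (fun t => hpart t = (Opi t, 0))) => //=.
  by move=> t u -> -> /=; rewrite OpiM !(mulr0, mul0r, addr0).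
by move=> i _; rewrite ev.
Qed.

Lemma Ogen_comm (g h : fgen r s p q) :
  Ogen g * Ogen h = (-1) ^+ (fpar g && fpar h) * (Ogen h * Ogen g).
Proof.
by rewrite mulr_sign -scaler_sign -!OpiM -OpiZ; apply/OpiP/fteq_comm.
Qed.

Lemma hpart_fteq t u : fteq t u -> hpart t = hpart u.
Proof.
elim=> {t u} //=.
- by move=> t u v _ -> _ ->.
- by move=> t t' _ ->.
- by move=> t t' u u' _ -> _ ->.
- by move=> t t' u u' _ -> _ ->.
- by move=> c t t' _ ->.
- by move=> t u v; rewrite !addrA.
- by move=> t u; congr pair; rewrite addrC.
- by move=> t; rewrite !add0r; case: hpart.
- by move=> t; rewrite !addNr.
- move=> t u v; congr pair; rewrite !(mulrDl, mulrDr) !mulrA;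
  by rewrite [RHS]addrACA; congr (_ + _); rewrite addrC.
- by move=> t; rewrite !(mul1r, mul0r, addr0); case: hpart.
- by move=> t; rewrite !(mulr1, mulr0, addr0, add0r); case: hpart.
- by move=> t u v; congr pair; rewrite !mulrDl addrACA.
- by move=> t u v; congr pair; rewrite !mulrDr addrACA.
- by move=> c d t; rewrite !scalerA.
- by move=> t; rewrite !scale1r; case: hpart.
- by move=> c t u; rewrite !scalerDr.
- by move=> c d t; rewrite !scalerDl.
- by move=> c t u; rewrite !scalerDr !scalerAl.
- by move=> c t u; rewrite !scalerDr !scalerAr.
- move=> g h; have := Ogen_comm g h.
  case: (fpar g) (fpar h) => [] [] /=; rewrite !(mulr0, mul0r, addr0, add0r) ?scaler0;
  by rewrite ?expr0 ?mul1r ?scale1r ?expr1 ?mulN1r ?scaleN1r => ->.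
- move=> I; rewrite hpart_det //= !(mulr0, mul0r, addr0); congr pair.
  by rewrite -OpiM; apply/OpiP/fteq_invX.
- move=> J; rewrite hpart_det //= !(mulr0, mul0r, addr0); congr pair.
  by rewrite -OpiM; apply/OpiP/fteq_invY.
Qed.

Definition Ohpart (x : O) : O * O := hpart (repr x).

Lemma Ohpart_pi t : Ohpart (Opi t) = hpart t.
Proof. exact/hpart_fteq/repr_Opi. Qed.

Lemma Ohpart_grade b x : Ograde b x -> Ohpart x = if b then (0, x) else (x, 0).
Proof.
elim=> {b x} [g|b||b x y _|b c x _|b c x y _].
- by rewrite Ohpart_pi.
- by rewrite -Opi0 Ohpart_pi /= if_same.
- by rewrite -Opi1 Ohpart_pi.
- elim/Ofun_ind: x => t; elim/Ofun_ind: y => u.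
  rewrite -OpiD !Ohpart_pi /= => -> _ ->.
  by case: b => /=; rewrite OpiD addr0.
- elim/Ofun_ind: x => t; rewrite -OpiZ !Ohpart_pi /= => ->.
  by case: b => /=; rewrite OpiZ scaler0.
- elim/Ofun_ind: x => t; elim/Ofun_ind: y => u.
  rewrite -OpiM !Ohpart_pi /= => -> _ ->.
  by case: b; case: c => /=; rewrite OpiM !(mulr0, mul0r, addr0, add0r).
Qed.

Lemma Ograde_disj x : Ograde false x -> Ograde true x -> x = 0.
Proof. by move=> /Ohpart_grade e /Ohpart_grade; rewrite e => -[]. Qed.

Lemma Osupercomm b c x y : Ograde b x -> Ograde c y ->
  x * y = (-1) ^+ (b && c) * (y * x).
Proof.
have sgC (e : bool) (u : O) : (-1) ^+ e * u = u * (-1) ^+ e.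
  by case: e; rewrite ?expr1 ?expr0 ?mulN1r ?mulrN1 ?mul1r ?mulr1.
have key g d z : Ograde d z ->
    Ogen g * z = (-1) ^+ (fpar g && d) * (z * Ogen g).
  elim=> {d z} [h|d||d z z' _ e _ e'|d a z _ e|d d' z z' _ e _ e'].
  - exact: Ogen_comm.
  - by rewrite mul0r !mulr0.
  - by rewrite andbF mul1r mulr1 mul1r.
  - by rewrite mulrDr e e' mulrDl mulrDr.
  - by rewrite -scalerAr e -scalerAl -scalerAr.
  - rewrite andb_addr signr_addb mulrA e -!mulrA e' [in RHS]mulrA.
    by rewrite -[RHS]mulrA; congr (_ * _); rewrite !mulrA sgC.
elim=> {b x} [g|b||b z z' _ e _ e'|b a z _ e|b d z z' _ e _ e'] yc.
- exact: key.
- by rewrite mul0r !mulr0.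
- by rewrite mul1r mulr1 mul1r.
- by rewrite mulrDl e // e' // mulrDr mulrDr.
- by rewrite -scalerAl e // -scalerAr -scalerAr.
- rewrite andb_addl signr_addb -mulrA (e' yc) (mulrA z) -(sgC _ z) -!mulrA.
  by rewrite (mulrA z) (e yc) [in RHS]mulrA [in RHS]sgC -!mulrA sgC -!mulrA.
Qed.

Definition Otilde : superalg k :=
  SuperAlg Ograde0 OgradeD OgradeZ Ograde_decomp Ograde_disj Ograde1 OgradeM
    Osupercomm.

(* f(M); it does not depend on the expression chosen for f when M is in
   [Mtilde], by [feval_fteq] *)
Definition Oeval (A : superalg k) (M : 'M[A]_(r + s, p + q)) (f : Otilde) : A :=
  feval M (repr (f : O)).

Definition SL_invariants : set Otilde :=
  [set f | forall (A : superalg k) (g : 'M[A]_(r + s)) (M : 'M[A]_(r + s, p + q)),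
    SL g -> Mtilde M -> Oeval (g *m M) f = Oeval M f].

Definition coord_mx : 'M[Otilde]_(r + s, p + q) :=
  block_mx (\matrix_(i, j) Ogen (GenX _ _ i j))
           (\matrix_(i, j) Ogen (GenAlpha _ _ i j))
           (\matrix_(i, j) Ogen (GenBeta _ _ i j))
           (\matrix_(i, j) Ogen (GenY _ _ i j)).

Definition pick_cols (c : 'I_r -> 'I_(p + q)) (d : 'I_s -> 'I_(p + q)) :
    'M[Otilde]_(r + s) :=
  row_mx (colsub c coord_mx) (colsub d coord_mx).

Definition even_cols (I : increasing r p) : 'I_r -> 'I_(p + q) :=
  fun a => lshift q (sval I a).
Definition odd_cols (J : increasing s q) : 'I_s -> 'I_(p + q) :=
  fun b => rshift p (sval J b).
Definition replace_col n (c : 'I_n -> 'I_(p + q)) (a : 'I_n) (j : 'I_(p + q)) :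
    'I_n -> 'I_(p + q) :=
  fun b => if b == a then j else c b.

Inductive super_minors : set Otilde :=
| minor I J :
    super_minors (Ber (pick_cols (even_cols I) (odd_cols J)))
| minor_star I J :
    super_minors (Berstar (pick_cols (even_cols I) (odd_cols J)))
| fake_minor I J (a : 'I_r) (lam : 'I_q) :
    super_minors (Ber
      (pick_cols (replace_col (even_cols I) a (rshift p lam)) (odd_cols J)))
| fake_minor_star I J (b : 'I_s) (m : 'I_p) :
    super_minors (Berstar
      (pick_cols (even_cols I) (replace_col (odd_cols J) b (lshift q m)))).

End FunctionAlgebra.

Arguments SL_invariants : clear implicits.
Arguments super_minors : clear implicits.

(* Main.v *)
(** The matrix [coord_mx] is itself a point of [Mtilde] over [Otilde], at which
every function [f] takes the value [f].  Let [G] be the square block of its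
first columns, [D] the diagonal matrix with Berezinian [Ber G] and
[g = D G^-1], so that [Ber g = 1] and an invariant [f] equals its value at
[g coord_mx].  By Cramer's rule the entries of [G^-1 coord_mx] are ratios of
(fake) super minors to [Ber G] or to [Berstar G = (Ber G)^-1], and the minors of
the diagonal blocks of [g coord_mx] are super minors up to powers of [Ber G], so
their inverses are again polynomials in the generators.

Conversely, Cramer's rule and the multiplicativity of [Ber] give the invariance
of the generators.  Multiplicativity comes from [Ber B * Berstar B = 1]: [Ber] is
visibly invariant under left multiplication by upper unitriangular block
matrices, and [Berstar] under lower ones.  That identity reduces to
[det (1 - PQ) det (1 - QP) = 1] for odd matrices [P] and [Q], which follows by
splitting off columns of [P] and taking Schur complements; it also yields the
invertibility of [det (1 - PQ)], without any appeal to nilpotency. *)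
Require Import Defs.
From HB Require Import structures.
From mathcomp Require Import all_boot all_algebra reals.
From mathcomp Require Import fingroup perm boolp classical_sets.

Set Implicit Arguments.
Unset Strict Implicit.
Unset Printing Implicit Defensive.

Import GRing.Theory Num.Theory.

Local Open Scope ring_scope.

(** * The even part and odd matrices *)

Section EvenPart.
Variables (k : numFieldType) (A : superalg k).

Lemma gradeN b (x : A) : grade A b x -> grade A b (- x).
Proof. by rewrite -scaleN1r; apply: gradeZ. Qed.

Lemma gradeB b (x y : A) : grade A b x -> grade A b y -> grade A b (x - y).
Proof. by move=> gx /gradeN; apply: gradeD. Qed.

Lemma grade_sum b I (r : seq I) (P : pred I) (F : I -> A) :
  (forall i, P i -> grade A b (F i)) -> grade A b (\sum_(i <- r | P i) F i).
Proof. by apply: big_ind; [apply: grade0|apply: gradeD]. Qed.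

Lemma even_comm (x y : A) : grade A false x -> x * y = y * x.
Proof.
move=> ex; have [y0 [y1 [e0 o1 ->]]] := grade_decomp y.
by rewrite mulrDr mulrDl (supercomm ex e0) (supercomm ex o1) !mul1r.
Qed.

Lemma odd_sqr (x : A) : grade A true x -> x * x = 0.
Proof.
move=> ox; have /eqP := supercomm ox ox; rewrite mulN1r -subr_eq0 opprK.
rewrite -mulr2n -scaler_nat => /eqP xx0.
(* Supercommutativity only gives [2 x x = 0]; the factor 2 is cancelled in the ground field, which
   has characteristic 0. *)
have n2 : (2%:R : k) != 0 by rewrite pnatr_eq0.
by rewrite -[LHS]scale1r -(mulVf n2) -scalerA xx0 scaler0.
Qed.

Definition even_pred : {pred A} := fun x => `[< grade A false x >].

Lemma even_subring : subring_closed even_pred.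
Proof.
split; first by apply/asboolP/grade1.
  by move=> x y /asboolP gx /asboolP gy; apply/asboolP/gradeB.
move=> x y /asboolP gx /asboolP gy; apply/asboolP.
exact: (gradeM gx gy).
Qed.
HB.instance Definition _ := GRing.isSubringClosed.Build A even_pred even_subring.

(** Determinants over [A] itself are Leibniz sums in a noncommutative ring. Matrices with even
    entries are lifted along [val] to this commutative ring, where the usual determinant theory
    applies. *)
Record even_part := EvenPart { even_val : A; even_valP : even_val \in even_pred }.
HB.instance Definition _ := [isSub for even_val].
HB.instance Definition _ := [Choice of even_part by <:].
HB.instance Definition _ := [SubChoice_isSubNzRing of even_part by <:].

Lemma even_partC : commutative (@GRing.mul even_part).
Proof.
by move=> x y; apply/val_inj/even_comm/asboolP/(even_valP x).
Qed.
HB.instance Definition _ := GRing.PzRing_hasCommutativeMul.Build even_part even_partC.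

Lemma val_even (x : even_part) : grade A false (val x).
Proof. exact/asboolP/(even_valP x). Qed.

Definition grmx b m n (M : 'M[A]_(m, n)) := forall i j, grade A b (M i j).

Lemma grmx_mul b c m n p (M : 'M_(m, n)) (N : 'M_(n, p)) :
  grmx b M -> grmx c N -> grmx (b (+) c) (M *m N).
Proof. by move=> gM gN i j; rewrite mxE; apply: grade_sum => l _; apply: gradeM. Qed.

Lemma grmxD b m n (M N : 'M_(m, n)) : grmx b M -> grmx b N -> grmx b (M + N).
Proof. by move=> gM gN i j; rewrite mxE; apply: gradeD. Qed.

Lemma grmxN b m n (M : 'M_(m, n)) : grmx b M -> grmx b (- M).
Proof. by move=> gM i j; rewrite mxE; apply: gradeN. Qed.

Lemma grmxB b m n (M N : 'M_(m, n)) : grmx b M -> grmx b N -> grmx b (M - N).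
Proof. by move=> gM /grmxN; apply: grmxD. Qed.

Lemma grmx0 b m n : grmx b (0 : 'M_(m, n)).
Proof. by move=> i j; rewrite mxE; apply: grade0. Qed.

Lemma grmx1 n : grmx false (1%:M : 'M_n).
Proof.
by move=> i j; rewrite mxE; case: eqP => _; [apply: grade1|apply: grade0].
Qed.

Lemma grmx_sub1 n (M : 'M_n) : grmx false M -> grmx false (1%:M - M).
Proof. by apply: grmxB; apply: grmx1. Qed.

Lemma even_mx_lift m n (M : 'M[A]_(m, n)) :
  grmx false M -> exists N : 'M[even_part]_(m, n), M = map_mx val N.
Proof.
move=> gM; exists (\matrix_(i, j) EvenPart (asboolT (gM i j))).
by apply/matrixP => i j; rewrite !mxE.
Qed.

Lemma map_even_inj m n : injective (map_mx val : 'M[even_part]_(m, n) -> 'M[A]_(m, n)).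
Proof.
by move=> M N /matrixP e; apply/matrixP => i j; apply: val_inj; have := e i j; rewrite !mxE.
Qed.

Lemma even_det_mulmx n (M N : 'M[A]_n) :
  grmx false M -> grmx false N -> \det (M *m N) = \det M * \det N.
Proof.
move=> /even_mx_lift[M' ->] /even_mx_lift[N' ->].
by rewrite -map_mxM !det_map_mx det_mulmx rmorphM.
Qed.

Lemma superalg_det_perm n (w : 'S_n) : \det (perm_mx w : 'M[A]_n) = (-1) ^+ w.
Proof.
by rewrite -(map_perm_mx (val : even_part -> A)) det_map_mx det_perm rmorph_sign.
Qed.

Lemma superalg_det1 n : \det (1%:M : 'M[A]_n) = 1.
Proof. by rewrite -perm_mx1 superalg_det_perm odd_perm1. Qed.

Lemma even_det_mx11 (M : 'M[A]_1) : grmx false M -> \det M = M 0 0.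
Proof. by move=> /even_mx_lift[N ->]; rewrite det_map_mx det_mx11 mxE. Qed.

Lemma det_block_schur (R : comNzRingType) m n (X T : 'M[R]_m) Y Z (W : 'M_n) :
  T *m X = 1%:M -> \det (block_mx X Y Z W) = \det X * \det (W - Z *m T *m Y).
Proof.
move=> TX; have -> : block_mx X Y Z W =
    block_mx 1%:M 0 (Z *m T) 1%:M *m block_mx X Y 0 (W - Z *m T *m Y).
  rewrite mulmx_block !mul1mx !mul0mx !addr0 -(mulmxA Z T X) TX mulmx1.
  by rewrite addrC subrK.
by rewrite det_mulmx det_lblock !det1 !mul1r det_ublock.
Qed.

Lemma even_det_block_schur m n (X T : 'M[A]_m) Y Z (W : 'M_n) :
  grmx false X -> grmx false T -> grmx false Y -> grmx false Z ->
  grmx false W -> T *m X = 1%:M ->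
  \det (block_mx X Y Z W) = \det X * \det (W - Z *m T *m Y).
Proof.
move=> /even_mx_lift[X' ->] /even_mx_lift[T' ->] /even_mx_lift[Y' ->].
move=> /even_mx_lift[Z' ->] /even_mx_lift[W' ->] TX.
rewrite -map_block_mx -!map_mxM -map_mxB !det_map_mx (@det_block_schur _ _ _ _ T').
  exact: rmorphM.
by apply: map_even_inj; rewrite map_mxM TX map_mx1.
Qed.

(** The inverse is the adjugate, formed over the even part and scaled by [e]. That [e] is itself
    even follows from uniqueness of inverses and [grade_inverse]. *)
Lemma invertible_even_mx n (M : 'M[A]_n) (e : A) :
  grmx false M -> is_inverse (\det M) e ->
  exists T, [/\ grmx false T, M *m T = 1%:M & T *m M = 1%:M].
Proof.
move=> gM dM; have ed := grade_det gM.
have ee : grade A false e.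
  have inv : invertible (\det M) by exists e.
  have <- : inverse (\det M) = e; last exact: grade_inverse.
  by rewrite -[LHS]mulr1 -dM.1 mulrA (inverseP inv).2 mul1r.
have [M' eM] := even_mx_lift gM; pose e' := EvenPart (asboolT ee).
have de : \det M' * e' = 1.
  by apply: val_inj; rewrite rmorphM -det_map_mx -eM dM.1.
exists (map_mx val (e' *: \adj M')); split.
- by move=> i j; rewrite mxE; apply: val_even.
- by rewrite eM -map_mxM -scalemxAr mul_mx_adj scale_scalar_mx mulrC de map_mx1.
- by rewrite eM -map_mxM -scalemxAl mul_adj_mx scale_scalar_mx mulrC de map_mx1.
Qed.

Lemma inverse_mxE n (M T : 'M[A]_n) :
  M *m T = 1%:M -> T *m M = 1%:M -> inverse_mx M = T.
Proof.
move=> MT TM; rewrite /inverse_mx; case: xgetP => [N _ [MN NM]|/(_ T)].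
  by rewrite -[N]mul1mx -TM -mulmxA MN mulmx1.
by case; split.
Qed.

Lemma inverse_mxP n (M : 'M[A]_n) : grmx false M -> invertible (\det M) ->
  [/\ grmx false (inverse_mx M), M *m inverse_mx M = 1%:M
    & inverse_mx M *m M = 1%:M].
Proof.
move=> gM [e /(invertible_even_mx gM)[T [gT MT TM]]].
by rewrite (inverse_mxE MT TM).
Qed.

Lemma inverseE (x y : A) : is_inverse x y -> inverse x = y.
Proof.
move=> xy; have xP : invertible x by exists y.
by rewrite -[LHS]mulr1 -xy.1 mulrA (inverseP xP).2 mul1r.
Qed.

Lemma even_is_inverse (x y : A) : grade A false x -> x * y = 1 -> is_inverse x y.
Proof. by move=> ex xy; split; rewrite // -even_comm. Qed.

Lemma invertibleM (x y : A) : invertible x -> invertible y -> invertible (x * y).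
Proof.
move=> [x' [xx' x'x]] [y' [yy' y'y]]; exists (y' * x'); split.
  by rewrite mulrA -(mulrA x) yy' mulr1.
by rewrite mulrA -(mulrA y') x'x mulr1.
Qed.

Lemma invertible_even_det n (M N : 'M[A]_n) :
  grmx false M -> grmx false N -> M *m N = 1%:M -> invertible (\det M).
Proof.
move=> gM gN MN; exists (\det N); apply: even_is_inverse (grade_det gM) _.
by rewrite -even_det_mulmx // MN superalg_det1.
Qed.

(** * Determinants of 1 - PQ for odd matrices P and Q *)

Definition odd_det_inverse m n := forall (P : 'M[A]_(m, n)) (Q : 'M_(n, m)),
  grmx true P -> grmx true Q -> \det (1%:M - P *m Q) * \det (1%:M - Q *m P) = 1.

Lemma odd_mul_even m n p (P : 'M_(m, n)) (Q : 'M_(n, p)) :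
  grmx true P -> grmx true Q -> grmx false (P *m Q).
Proof. exact: grmx_mul. Qed.

Lemma odd_det_inverseC m n : odd_det_inverse m n -> odd_det_inverse n m.
Proof.
move=> C P Q oP oQ; rewrite even_comm ?C //.
by apply/grade_det/grmx_sub1/odd_mul_even.
Qed.

(** Write [P = (P1 p1)] and let [Q] have the row blocks [Q1], [q1]. Factoring out [X = 1 - P1 Q1]
    gives [det (1 - PQ) = det X det (1 - T p1 q1)] with [T] the inverse of [X]. The Schur complement
    of [V = 1 - Q1 P1] gives [det (1 - QP) = det V det (1 - q1 T p1)]. The two hypotheses apply to
    [(P1, Q1)] and to [(T p1, q1)]. *)
Lemma odd_det_inverseD m n p :
  odd_det_inverse m n -> odd_det_inverse m p -> odd_det_inverse m (n + p).
Proof.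
move=> Cn Cp P Q; rewrite -(hsubmxK P) -(vsubmxK Q).
move: (lsubmx P) (rsubmx P) (usubmx Q) (dsubmx Q) => P1 p1 Q1 q1 oP oQ.
have {oP}[oP op] : grmx true P1 /\ grmx true p1.
  by split=> i j; [have := oP i (lshift _ j)|have := oP i (rshift _ j)];
    rewrite ?row_mxEl ?row_mxEr.
have {oQ}[oQ oq] : grmx true Q1 /\ grmx true q1.
  by split=> i j; [have := oQ (lshift _ i) j|have := oQ (rshift _ i) j];
    rewrite ?col_mxEu ?col_mxEd.
rewrite mul_row_col mul_col_row opprD addrA.
set X := 1%:M - P1 *m Q1; set V := 1%:M - Q1 *m P1.
have eX : grmx false X by apply/grmx_sub1/odd_mul_even.
have eV : grmx false V by apply/grmx_sub1/odd_mul_even.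
have XV : \det X * \det V = 1 by apply: Cn.
have [U [eU VU UV]] : exists U, [/\ grmx false U, V *m U = 1%:M & U *m V = 1%:M].
  apply: (@invertible_even_mx _ _ (\det X)) => //; apply: even_is_inverse.
    exact: grade_det.
  by rewrite even_comm //; apply: grade_det.
have [T [eT XT TX]] : exists T, [/\ grmx false T, X *m T = 1%:M & T *m X = 1%:M].
  apply: (@invertible_even_mx _ _ (\det V)) => //; apply: even_is_inverse => //.
  exact: grade_det.
(* From [X P1 = P1 V] one gets [X (1 + P1 U Q1) = X + P1 Q1 = 1]; this formula identifies the Schur
   complement below with [1 - q1 T p1]. *)
have TE : T = 1%:M + P1 *m U *m Q1.
  have XP : X *m P1 = P1 *m V by rewrite mulmxBl mul1mx mulmxBr mulmx1 mulmxA.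
  rewrite -[RHS]mul1mx -{1}TX -mulmxA mulmxDr mulmx1 !mulmxA XP -(mulmxA P1) VU.
  by rewrite mulmx1 subrK mulmx1.
have eTp : grmx true (T *m p1) by apply: (grmx_mul eT op).
have -> : X - p1 *m q1 = X *m (1%:M - T *m p1 *m q1).
  by rewrite mulmxBr mulmx1 -mulmxA (mulmxA X) XT mul1mx.
rewrite even_det_mulmx //; last exact/grmx_sub1/odd_mul_even.
have -> : 1%:M - block_mx (Q1 *m P1) (Q1 *m p1) (q1 *m P1) (q1 *m p1) =
    block_mx V (- (Q1 *m p1)) (- (q1 *m P1)) (1%:M - q1 *m p1).
  by rewrite (scalar_mx_block n p) opp_block_mx add_block_mx !sub0r.
rewrite (even_det_block_schur eV eU) //; first last.
- exact/grmx_sub1/odd_mul_even.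
- exact/grmxN/odd_mul_even.
- exact/grmxN/odd_mul_even.
have -> : 1%:M - q1 *m p1 - - (q1 *m P1) *m U *m - (Q1 *m p1) =
    1%:M - q1 *m (T *m p1).
  rewrite TE mulmxDl mul1mx mulmxDr !mulNmx mulmxN opprK opprD addrA.
  by rewrite !mulmxA.
rewrite [\det V * _]even_comm; last exact: grade_det.
by rewrite mulrA -(mulrA (\det X)) Cp // mulr1.
Qed.

Lemma odd_det_inverse0 m : odd_det_inverse m 0.
Proof.
move=> P Q _ _; rewrite thinmx0 mul0mx subr0 superalg_det1.
by rewrite [_ - _]flatmx0 -(flatmx0 1%:M) superalg_det1 mulr1.
Qed.

(** For odd [x] and [y], [y x = - x y] and [(x y)^2 = 0], so the product is
    [(1 - x y) (1 + x y) = 1]. *)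
Lemma odd_det_inverse11 : odd_det_inverse 1 1.
Proof.
move=> P Q oP oQ; rewrite !even_det_mx11; try exact/grmx_sub1/odd_mul_even.
rewrite !mxE !big_ord1 /=.
have := oP 0 0; have := oQ 0 0; move: (P 0 0) (Q 0 0) => x y oy ox.
rewrite (supercomm oy ox) /= mulN1r opprK mulrBl mul1r mulrDr mulr1 -mulrA.
by rewrite (mulrA y) (supercomm oy ox) mulN1r mulNr mulrN -mulrA odd_sqr //
  !mulr0 oppr0 addr0 addrK.
Qed.

(* Unlike for even matrices, where [\det (1 - PQ) = \det (1 - QP)]. *)
Lemma odd_detP m n : odd_det_inverse m n.
Proof.
(* A single column is handled by exchanging the roles of [P] and [Q], which turns it into a row that
   grows one entry at a time; columns of [P] are then added one by one. *)
have C1 m' : odd_det_inverse m' 1.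
  apply: odd_det_inverseC; elim: m' => [|m' IH]; first exact: odd_det_inverse0.
  exact: (@odd_det_inverseD 1 1 m' odd_det_inverse11 IH).
elim: n => [|n IH]; first exact: odd_det_inverse0.
exact: (@odd_det_inverseD m 1 n (C1 m) IH).
Qed.

Lemma invertible_det_sub1 m n (P : 'M_(m, n)) (Q : 'M_(n, m)) :
  grmx true P -> grmx true Q -> invertible (\det (1%:M - P *m Q)).
Proof.
move=> oP oQ; exists (\det (1%:M - Q *m P)); apply: even_is_inverse.
  exact/grade_det/grmx_sub1/odd_mul_even.
exact: odd_detP.
Qed.

End EvenPart.

(** * Cramer's rule *)

Definition set_col (R : Type) m n (M : 'M[R]_(m, n)) j (c : 'cV_m) : 'M[R]_(m, n) :=
  \matrix_(a, b) if b == j then c a 0 else M a b.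

(** The parity exchange: [Berstar B] unfolds to [Ber (swapmx B)], so facts on [Berstar] are
    transported from [Ber]. *)
Definition swapmx (R : Type) r s p q (B : 'M[R]_(r + s, p + q)) : 'M[R]_(s + r, q + p) :=
  block_mx (drsubmx B) (dlsubmx B) (ursubmx B) (ulsubmx B).

Lemma swapmx_mul (R : pzRingType) r1 s1 r2 s2 r3 s3
    (M : 'M[R]_(r1 + s1, r2 + s2)) (N : 'M_(r2 + s2, r3 + s3)) :
  swapmx (M *m N) = swapmx M *m swapmx N.
Proof.
rewrite -[M]submxK -[N]submxK mulmx_block /swapmx.
rewrite !(block_mxKul, block_mxKur, block_mxKdl, block_mxKdr) mulmx_block.
by congr block_mx; rewrite addrC.
Qed.

Lemma swapmx1 (R : pzRingType) r s : swapmx (1%:M : 'M[R]_(r + s)) = 1%:M.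
Proof.
rewrite /swapmx scalar_mx_block block_mxKul block_mxKur block_mxKdl block_mxKdr.
by rewrite -scalar_mx_block.
Qed.

Section Cramer.
Variables (k : numFieldType) (A : superalg k).

(** Even elements are central, so a product with at most one factor of unknown parity does not
    depend on where that factor stands. This undoes the row order of the Leibniz products. *)
Lemma prod_move_right n (F : 'I_n -> A) a :
  (forall b, b != a -> grade A false (F b)) ->
  \prod_b F b = (\prod_(b | b != a) F b) * F a.
Proof.
move=> evF.
suff key t : uniq t -> \prod_(b <- t) F b =
    (\prod_(b <- t | b != a) F b) * (if a \in t then F a else 1).
  by rewrite key ?index_enum_uniq // mem_index_enum.
elim: t => [|b t IH] /=; first by rewrite !big_nil mulr1.
case/andP=> bt /IH{}IH; rewrite !big_cons inE {}IH [a == b]eq_sym.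
have [eb|nb] := eqVneq b a; last by rewrite mulrA.
have /negPf -> : a \notin t by rewrite -eb.
rewrite /= eb mulr1 -even_comm //.
apply: (big_ind (grade A false)) => [|x y|c]; [exact: grade1| |exact: evF].
exact: (gradeM (b := false) (c := false)).
Qed.

Lemma even_det_set_col n (S : 'M[A]_n) i j : grmx false S ->
  \det (set_col S i (col j S)) = if j == i then \det S else 0.
Proof.
move=> eS; have [->|ji] := eqVneq j i.
  by congr (\det _); apply/matrixP => a b; rewrite !mxE; case: eqP => [->|].
have [N ->] := even_mx_lift eS.
have -> : set_col (map_mx val N) i (col j (map_mx val N)) =
    map_mx (val : even_part A -> A) (set_col N i (col j N)).
  by apply/matrixP => a b; rewrite !mxE; case: eqP.
rewrite det_map_mx -det_tr (determinant_alternate ji) ?rmorph0 // => a.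
by rewrite !mxE eqxx (negPf ji).
Qed.

(* The entries of [c] and [v] need not be even: each Leibniz product contains
   one of them, which commutes with the other, even, factors. *)
Lemma even_det_cramer n (S : 'M[A]_n) (v c : 'cV_n) i :
  grmx false S -> S *m v = c -> \det (set_col S i c) = \det S * v i 0.
Proof.
move=> eS <-.
pose L (w : 'S_n) := (-1) ^+ w * \prod_(a | a != (w^-1)%g i) S a (w a).
have detL (d : 'cV_n) : \det (set_col S i d) = \sum_(w : 'S_n) L w * d ((w^-1)%g i) 0.
  apply: eq_bigr => w _; rewrite /L -mulrA; congr (_ * _).
  have wE a : (w a == i) = (a == (w^-1)%g i).
    by apply/eqP/eqP => [<-|->]; rewrite ?permK ?permKV.
  rewrite (@prod_move_right _ _ ((w^-1)%g i)) => [|b /negPf nb].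
    congr (_ * _); last by rewrite mxE permKV eqxx.
    by apply: eq_bigr => b /negPf nb; rewrite mxE wE nb.
  by rewrite mxE wE nb.
rewrite detL.
(* By [detL] the determinant is additive in the replaced column and coefficients come out on the
   right. The column [S *m v] is the combination of the columns of [S] with right coefficients
   [v j 0], and only [j = i] avoids a repeated column. *)
transitivity (\sum_j \det (set_col S i (col j S)) * v j 0).
  under [RHS]eq_bigr do rewrite detL mulr_suml.
  rewrite exchange_big; apply: eq_bigr => w _ /=.
  by rewrite mxE mulr_sumr; apply: eq_bigr => j _; rewrite mxE mulrA.
rewrite (bigD1 i) //= big1 => [|j /negPf ji]; rewrite even_det_set_col //.
  by rewrite eqxx addr0.
by rewrite ji mul0r.
Qed.

End Cramer.

(** * Multiplicativity of the Berezinian *)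

Section Berezinian.
Variables (k : numFieldType) (A : superalg k).

Lemma even_supermx_mul r1 s1 r2 s2 r3 s3
    (M : 'M[A]_(r1 + s1, r2 + s2)) (N : 'M_(r2 + s2, r3 + s3)) :
  even_supermx M -> even_supermx N -> even_supermx (M *m N).
Proof.
rewrite -[M]submxK -[N]submxK mulmx_block /even_supermx.
rewrite !(block_mxKul, block_mxKur, block_mxKdl, block_mxKdr).
case=> [M1 M2 M3 M4] [N1 N2 N3 N4]; split.
- by apply: grmxD; [apply: (grmx_mul M1 N1)|apply: (grmx_mul M2 N3)].
- by apply: grmxD; [apply: (grmx_mul M1 N2)|apply: (grmx_mul M2 N4)].
- by apply: grmxD; [apply: (grmx_mul M3 N1)|apply: (grmx_mul M4 N3)].
- by apply: grmxD; [apply: (grmx_mul M3 N2)|apply: (grmx_mul M4 N4)].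
Qed.

Lemma even_supermx_swap r s p q (M : 'M[A]_(r + s, p + q)) :
  even_supermx M -> even_supermx (swapmx M).
Proof.
by case=> *; split; rewrite ?(block_mxKul, block_mxKur, block_mxKdl, block_mxKdr).
Qed.

(** Factor [d + v b = d (1 + d^-1 v b)]; the second factor is 1 minus a product of two odd
    matrices. *)
Lemma invertible_det_oddD r s (d : 'M[A]_r) (v : 'M_(r, s)) (b : 'M_(s, r)) :
  grmx false d -> grmx true v -> grmx true b -> invertible (\det d) ->
  invertible (\det (d + v *m b)).
Proof.
move=> ed ov ob invd; have [eT dT Td] := inverse_mxP ed invd.
set T := inverse_mx d in eT dT Td.
have oTv : grmx true (- (T *m v)) by apply: grmxN; apply: (grmx_mul eT ov).
have -> : d + v *m b = d *m (1%:M - - (T *m v) *m b).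
  by rewrite mulNmx opprK mulmxDr mulmx1 !mulmxA dT mul1mx.
rewrite even_det_mulmx //; last exact/grmx_sub1/odd_mul_even.
by apply: invertibleM => //; apply: invertible_det_sub1.
Qed.

(** A working form of invertibility that makes both [Ber] and [Berstar] meaningful. It amounts to
    having an even inverse, by [supermx_unitP] and [supermx_unit_inverse]. *)
Definition supermx_unit r s (B : 'M[A]_(r + s)) :=
  [/\ even_supermx B, invertible (\det (ulsubmx B)) & invertible (\det (drsubmx B))].

Lemma supermx_unit_mul r s (B C : 'M[A]_(r + s)) :
  supermx_unit B -> supermx_unit C -> supermx_unit (B *m C).
Proof.
move=> [eB B1i B4i] [eC C1i C4i]; split; first exact: even_supermx_mul.
  move: eB eC B1i C1i; rewrite -[B]submxK -[C]submxK mulmx_block /even_supermx.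
  rewrite !(block_mxKul, block_mxKur, block_mxKdl, block_mxKdr).
  case=> [B1 B2 B3 B4] [C1 C2 C3 C4] B1i C1i.
  apply: invertible_det_oddD => //; first exact: (grmx_mul B1 C1).
  by rewrite even_det_mulmx //; apply: invertibleM.
move: eB eC B4i C4i; rewrite -[B]submxK -[C]submxK mulmx_block /even_supermx.
rewrite !(block_mxKul, block_mxKur, block_mxKdl, block_mxKdr).
case=> [B1 B2 B3 B4] [C1 C2 C3 C4] B4i C4i.
rewrite addrC; apply: invertible_det_oddD => //; first exact: (grmx_mul B4 C4).
by rewrite even_det_mulmx //; apply: invertibleM.
Qed.

Lemma supermx_unit_swap r s (B : 'M[A]_(r + s)) :
  supermx_unit B -> supermx_unit (swapmx B).
Proof.
case=> [eB B1 B4]; split; first exact: even_supermx_swap.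
  by rewrite block_mxKul.
by rewrite block_mxKdr.
Qed.

Lemma mulmx1_ul r s (B C : 'M[A]_(r + s)) : B *m C = 1%:M ->
  ulsubmx B *m ulsubmx C = 1%:M - ursubmx B *m dlsubmx C.
Proof.
rewrite -[B in B *m _]submxK -[C in _ *m C]submxK mulmx_block scalar_mx_block.
by case/eq_block_mx=> <- _ _ _; rewrite addrK.
Qed.

(** The upper left block of [B C = 1] reads [B1 C1 = 1 - B2 C3]. The right side is invertible
    because [B2] and [C3] are odd, which gives [B1] an even right inverse. *)
Lemma invertible_det_ul r s (B C : 'M[A]_(r + s)) :
  even_supermx B -> even_supermx C -> B *m C = 1%:M ->
  invertible (\det (ulsubmx B)).
Proof.
move=> [B1 B2 B3 B4] [C1 C2 C3 C4] /mulmx1_ul BC.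
have e1 : grmx false (1%:M - ursubmx B *m dlsubmx C).
  exact/grmx_sub1/odd_mul_even.
have [|eT XT _] := inverse_mxP e1; first exact: invertible_det_sub1.
move: XT; rewrite -{1}BC -mulmxA; apply: invertible_even_det => //.
exact: (grmx_mul C1 eT).
Qed.

Lemma supermx_unitP r s (B C : 'M[A]_(r + s)) :
  even_supermx B -> even_supermx C -> B *m C = 1%:M -> supermx_unit B.
Proof.
move=> eB eC BC; split=> //; first exact: invertible_det_ul BC.
rewrite -(block_mxKul (drsubmx B) (dlsubmx B) (ursubmx B) (ulsubmx B)).
apply: (@invertible_det_ul _ _ (swapmx B) (swapmx C)).
- exact: even_supermx_swap.
- exact: even_supermx_swap.
- by rewrite -swapmx_mul BC swapmx1.
Qed.

(** With [P = a^-1 b] and [Q = d^-1 c], the two Schur complements are [a (1 - PQ)] and [d (1 - QP)].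
    The determinants of [a] and [d] cancel, leaving [odd_detP]. *)
Lemma Ber_Berstar r s (G : 'M[A]_(r + s)) : supermx_unit G -> Ber G * Berstar G = 1.
Proof.
case=> [[]]; rewrite /Berstar /Ber block_mxKul block_mxKur block_mxKdl block_mxKdr.
move: (ulsubmx G) (ursubmx G) (dlsubmx G) (drsubmx G) => a b c d ea ob oc ed ia id.
have [eTa aT Ta] := inverse_mxP ea ia; have [eTd dT Td] := inverse_mxP ed id.
move: (inverse_mx a) (inverse_mx d) eTa aT Ta eTd dT Td => T U eT aT Ta eU dU Ud.
have oP : grmx true (T *m b) by apply: (grmx_mul eT ob).
have oQ : grmx true (U *m c) by apply: (grmx_mul eU oc).
have -> : a - b *m U *m c = a *m (1%:M - (T *m b) *m (U *m c)).
  by rewrite mulmxBr mulmx1 !mulmxA aT mul1mx.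
have -> : d - c *m T *m b = d *m (1%:M - (U *m c) *m (T *m b)).
  by rewrite mulmxBr mulmx1 !mulmxA dU mul1mx.
rewrite !even_det_mulmx //; try exact/grmx_sub1/odd_mul_even.
have := odd_detP oP oQ; set u := \det (_ - _); set v := \det (_ - _) => uv.
have [xx' _] := inverseP ia; have [yy' y'y] := inverseP id.
have eu : grade A false u by apply/grade_det/grmx_sub1/odd_mul_even.
rewrite [\det a * u]even_comm; last exact: grade_det.
rewrite !mulrA -(mulrA _ (\det a)) xx' mulr1 -(even_comm _ eu) -(mulrA u) y'y.
by rewrite mulr1.
Qed.

Lemma even_Ber r s (B : 'M[A]_(r + s)) : supermx_unit B -> grade A false (Ber B).
Proof.
case=> [[g1 g2 g3 g4] _ i4]; have [eT _ _] := inverse_mxP g4 i4.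
apply: (gradeM (b := false) (c := false)); first exact: grade_inverse (grade_det g4) i4.
by apply/grade_det/grmxB => //; apply: odd_mul_even g3; apply: (grmx_mul g2 eT).
Qed.

(** The lower blocks of [Z] are unchanged, and the contributions of [u] to the Schur complement
    cancel. *)
Lemma Ber_upper r s (u : 'M[A]_(r, s)) (Z : 'M_(r + s)) :
  supermx_unit Z -> Ber (block_mx 1%:M u 0 1%:M *m Z) = Ber Z.
Proof.
case=> [[e1 _ _ e4] _ i4]; have [_ ZT _] := inverse_mxP e4 i4.
rewrite -{1}[Z]submxK mulmx_block !mul0mx !mul1mx !add0r /Ber.
rewrite !(block_mxKul, block_mxKur, block_mxKdl, block_mxKdr).
congr (_ * \det _); rewrite !mulmxDl -(mulmxA u) ZT mulmx1 opprD addrACA subrr.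
by rewrite addr0.
Qed.

Lemma Ber_diag r s (x : 'M[A]_r) (y : 'M[A]_s) (Z : 'M_(r + s)) :
  grmx false x -> grmx false y -> invertible (\det y) -> supermx_unit Z ->
  Ber (block_mx x 0 0 y *m Z) = inverse (\det y) * \det x * Ber Z.
Proof.
move=> ex ey iy [[e1 o2 o3 e4] _ i4]; have [eT ZT TZ] := inverse_mxP e4 i4.
have [eU yU Uy] := inverse_mxP ey iy.
rewrite -{1}[Z]submxK mulmx_block !mul0mx !add0r !addr0 /Ber.
rewrite !(block_mxKul, block_mxKur, block_mxKdl, block_mxKdr).
set T := inverse_mx (drsubmx Z) in eT ZT TZ *.
set U := inverse_mx y in eU yU Uy.
rewrite (@inverse_mxE _ _ _ _ (T *m U)); first last.
- by rewrite mulmxA -(mulmxA T) Uy mulmx1 TZ.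
- by rewrite mulmxA -(mulmxA y) ZT mulmx1 yU.
have -> : x *m ulsubmx Z - x *m ursubmx Z *m (T *m U) *m (y *m dlsubmx Z) =
    x *m (ulsubmx Z - ursubmx Z *m T *m dlsubmx Z).
  by rewrite mulmxBr !mulmxA -(mulmxA _ U) Uy mulmx1.
rewrite !even_det_mulmx //; last first.
  by apply: grmxB => //; apply: odd_mul_even o3; apply: (grmx_mul o2 eT).
have [yy' y'y] := inverseP iy; have [zz' z'z] := inverseP i4.
have eiy := grade_inverse (grade_det ey) iy.
rewrite (@inverseE _ _ _ (inverse (\det (drsubmx Z)) * inverse (\det y))).
  rewrite !mulrA; congr (_ * _); rewrite -mulrA.
  exact/even_comm/(grade_inverse (grade_det e4) i4).
split; first by rewrite mulrA -(mulrA (\det y)) zz' mulr1.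
by rewrite mulrA -(mulrA (inverse _)) y'y mulr1.
Qed.

Lemma Berstar_lower r s (v : 'M[A]_(s, r)) (Z : 'M_(r + s)) :
  supermx_unit Z -> Berstar (block_mx 1%:M 0 v 1%:M *m Z) = Berstar Z.
Proof.
move=> uZ; rewrite /Berstar -!/(swapmx _) swapmx_mul {1}/swapmx.
rewrite !(block_mxKul, block_mxKur, block_mxKdl, block_mxKdr).
exact/Ber_upper/supermx_unit_swap.
Qed.

Lemma supermx_unit_block r s (x : 'M[A]_r) u v (y : 'M[A]_s) :
  grmx false x -> grmx true u -> grmx true v -> grmx false y ->
  invertible (\det x) -> invertible (\det y) -> supermx_unit (block_mx x u v y).
Proof.
by move=> *; split; [split| |];
  rewrite ?block_mxKul ?block_mxKur ?block_mxKdl ?block_mxKdr.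
Qed.

Lemma invertible1 : invertible (1 : A).
Proof. by exists 1; split; rewrite mulr1. Qed.

Lemma supermx_unit_upper r s (u : 'M[A]_(r, s)) :
  grmx true u -> supermx_unit (block_mx 1%:M u 0 1%:M).
Proof.
by move=> ou; apply: supermx_unit_block; rewrite ?superalg_det1;
  do ?[exact: grmx1 | exact: grmx0 | exact: invertible1].
Qed.

Lemma supermx_unit_lower r s (v : 'M[A]_(s, r)) :
  grmx true v -> supermx_unit (block_mx 1%:M 0 v 1%:M).
Proof.
by move=> ov; apply: supermx_unit_block; rewrite ?superalg_det1;
  do ?[exact: grmx1 | exact: grmx0 | exact: invertible1].
Qed.

Lemma inverse1 : inverse (1 : A) = 1.
Proof. by apply: inverseE; split; rewrite mulr1. Qed.

(** The corresponding invariance of [Berstar] is direct, and on invertible supermatrices [Ber] is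
    the inverse of [Berstar]. *)
Lemma Ber_lower r s (v : 'M[A]_(s, r)) (Z : 'M_(r + s)) :
  grmx true v -> supermx_unit Z -> Ber (block_mx 1%:M 0 v 1%:M *m Z) = Ber Z.
Proof.
move=> ov uZ; have uLZ := supermx_unit_mul (supermx_unit_lower ov) uZ.
have := Ber_Berstar uZ; have := Ber_Berstar uLZ; rewrite Berstar_lower // => e1 e2.
have e3 : Berstar Z * Ber Z = 1.
  by rewrite -even_comm //; apply: even_Ber.
by move: (Ber (_ *m Z)) e1 => x e1; rewrite -[x]mulr1 -e3 mulrA e1 mul1r.
Qed.

(** Block Gauss elimination from the lower right block: [u = B2 B4^-1], [v = B4^-1 B3], and [S] is
    the Schur complement, invertible because it differs from [B1] by a product of odd matrices. *)
Lemma supermx_unit_UDL r s (B : 'M[A]_(r + s)) : supermx_unit B ->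
  exists u S y v, [/\ grmx true u, grmx true v, supermx_unit (block_mx S 0 0 y)
    & B = block_mx 1%:M u 0 1%:M *m (block_mx S 0 0 y *m block_mx 1%:M 0 v 1%:M)].
Proof.
move=> [[e1 o2 o3 e4] i1 i4]; have [eT BT TB] := inverse_mxP e4 i4.
pose S := ulsubmx B - ursubmx B *m inverse_mx (drsubmx B) *m dlsubmx B.
set T := inverse_mx (drsubmx B) in eT BT TB S *.
have ou : grmx true (ursubmx B *m T) by apply: (grmx_mul o2 eT).
have ov : grmx true (T *m dlsubmx B) by apply: (grmx_mul eT o3).
have eS : grmx false S by apply: grmxB => //; apply: odd_mul_even.
have iS : invertible (\det S).
  rewrite /S -mulNmx; apply: invertible_det_oddD => //; exact: grmxN.
exists (ursubmx B *m T), S, (drsubmx B), (T *m dlsubmx B); split=> //.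
  by apply: supermx_unit_block; do ?exact: grmx0.
rewrite !mulmx_block !mul0mx !mulmx0 !mul1mx !mulmx1 !addr0 !add0r.
rewrite -[LHS]submxK /S !mulmxA BT mul1mx -(mulmxA _ T (drsubmx B)) TB mulmx1.
by rewrite subrK.
Qed.

(** Only the left factor is decomposed. Its triangular parts leave [Ber] unchanged and its diagonal
    part scales it by a factor which turns out to be [Ber B]. *)
Lemma Ber_mul r s (B C : 'M[A]_(r + s)) :
  supermx_unit B -> supermx_unit C -> Ber (B *m C) = Ber B * Ber C.
Proof.
move=> /supermx_unit_UDL[u [S [y [v [ou ov uD ->]]]]] uC.
have uU := supermx_unit_upper ou; have uL := supermx_unit_lower ov.
have [[eS _ _ ey] _ iy] := uD.
rewrite block_mxKul in eS; rewrite block_mxKdr in ey iy.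
have uDL : supermx_unit (block_mx S 0 0 y *m block_mx 1%:M 0 v 1%:M).
  exact: supermx_unit_mul.
have uLC := supermx_unit_mul uL uC; have uDLC := supermx_unit_mul uD uLC.
rewrite -!mulmxA !Ber_upper // !Ber_diag // Ber_lower //.
have -> : Ber (block_mx 1%:M 0 v 1%:M) = 1; last by rewrite mulr1.
rewrite /Ber block_mxKul block_mxKur block_mxKdr !mul0mx subr0 !superalg_det1.
by rewrite inverse1 mulr1.
Qed.

Lemma supermx_unit_inverse r s (B : 'M[A]_(r + s)) : supermx_unit B ->
  exists C, [/\ supermx_unit C, B *m C = 1%:M & C *m B = 1%:M].
Proof.
move=> /supermx_unit_UDL[u [S [y [v [ou ov uD ->]]]]].
have uU := supermx_unit_upper (grmxN ou); have uL := supermx_unit_lower (grmxN ov).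
have [[eS _ _ ey] iS iy] := uD.
rewrite block_mxKul in eS iS; rewrite block_mxKdr in ey iy.
have [eT ST TS] := inverse_mxP eS iS; have [eU yU Uy] := inverse_mxP ey iy.
have uD' : supermx_unit (block_mx (inverse_mx S) 0 0 (inverse_mx y)).
  apply: supermx_unit_block => //; try exact: grmx0.
    exact: (invertible_even_det eT eS TS).
  exact: (invertible_even_det eU ey Uy).
exists (block_mx 1%:M 0 (- v) 1%:M *m
  (block_mx (inverse_mx S) 0 0 (inverse_mx y) *m block_mx 1%:M (- u) 0 1%:M)).
split; first by do !apply: supermx_unit_mul.
- rewrite -!mulmxA (mulmxA (block_mx 1%:M 0 v 1%:M)) [X in _ *m (_ *m (X *m _))]mulmx_block.
  rewrite !mul0mx !mulmx0 !mul1mx !mulmx1 !addr0 !add0r subrr -scalar_mx_block mul1mx.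
  rewrite (mulmxA (block_mx S 0 0 y)) [X in _ *m (X *m _)]mulmx_block.
  rewrite !mul0mx !mulmx0 !addr0 !add0r ST yU -scalar_mx_block mul1mx mulmx_block.
  by rewrite !mul0mx !mulmx0 !mul1mx !mulmx1 !addr0 !add0r addNr -scalar_mx_block.
- rewrite -!mulmxA (mulmxA (block_mx 1%:M (- u) 0 1%:M)) [X in _ *m (_ *m (X *m _))]mulmx_block.
  rewrite !mul0mx !mulmx0 !mul1mx !mulmx1 !addr0 !add0r subrr -scalar_mx_block mul1mx.
  rewrite (mulmxA (block_mx _ 0 0 _)) [X in _ *m (X *m _)]mulmx_block.
  rewrite !mul0mx !mulmx0 !addr0 !add0r TS Uy -scalar_mx_block mul1mx mulmx_block.
  by rewrite !mul0mx !mulmx0 !mul1mx !mulmx1 !addr0 !add0r addNr -scalar_mx_block.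
Qed.

Lemma Ber_is_inverse r s (B : 'M[A]_(r + s)) :
  supermx_unit B -> is_inverse (Ber B) (Berstar B).
Proof. by move=> uB; apply: even_is_inverse (even_Ber uB) (Ber_Berstar uB). Qed.

Lemma Berstar_mul r s (B C : 'M[A]_(r + s)) :
  supermx_unit B -> supermx_unit C -> Ber B = 1 -> Berstar (B *m C) = Berstar C.
Proof.
move=> uB uC B1; rewrite -(inverseE (Ber_is_inverse uC)) -[Ber C]mul1r -B1.
by rewrite -Ber_mul // (inverseE (Ber_is_inverse (supermx_unit_mul uB uC))).
Qed.

(** Replacing an even column affects only column [i] of the Schur complement [S], which becomes
    [c1 - B2 B4^-1 c2 = S w1], with [c1], [c2] the blocks of [c] and [w1] the upper block of [w].
    The ordinary Cramer rule for [S] finishes. No parity is asked of [c], so fake supermatrices of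
    type I are covered. *)
Lemma Ber_cramer r s (G : 'M[A]_(r + s)) (w c : 'cV_(r + s)) i :
  even_supermx G -> invertible (\det (drsubmx G)) -> G *m w = c ->
  Ber (set_col G (lshift s i) c) = Ber G * w (lshift s i) 0.
Proof.
move=> [e1 o2 o3 e4] i4 Gw; have [eT GT TG] := inverse_mxP e4 i4.
set S := ulsubmx G - ursubmx G *m inverse_mx (drsubmx G) *m dlsubmx G.
have eS : grmx false S.
  by apply: grmxB => //; apply: odd_mul_even o3; apply: (grmx_mul o2 eT).
have blocks : [/\ ulsubmx (set_col G (lshift s i) c) = set_col (ulsubmx G) i (usubmx c),
   ursubmx (set_col G (lshift s i) c) = ursubmx G,
   dlsubmx (set_col G (lshift s i) c) = set_col (dlsubmx G) i (dsubmx c) &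
   drsubmx (set_col G (lshift s i) c) = drsubmx G].
  by split; apply/matrixP => a b; rewrite !mxE ?(inj_eq (@lshift_inj _ _)) // eq_rlshift.
have {blocks}[b1 b2 b3 b4] := blocks.
rewrite /Ber b1 b2 b3 b4 -mulrA; congr (_ * _).
have -> : w (lshift s i) 0 = usubmx w i 0 by rewrite mxE.
rewrite -(@even_det_cramer _ _ _ _ _ (S *m usubmx w)) //; congr (\det _).
have -> : S *m usubmx w =
    usubmx c - ursubmx G *m inverse_mx (drsubmx G) *m dsubmx c.
  rewrite -Gw -mul_usub_mx -mul_dsub_mx.
  rewrite -[usubmx G]hsubmxK -[dsubmx G]hsubmxK -{2 3}[w]vsubmxK !mul_row_col.
  rewrite -/(ulsubmx G) -/(ursubmx G) -/(dlsubmx G) -/(drsubmx G).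
  rewrite mulmxDr !mulmxA -(mulmxA _ _ (drsubmx G)) TG mulmx1.
  by rewrite mulmxBl opprD addrACA subrr addr0.
apply/matrixP => a b; rewrite !mxE; case: eqP => [->|/eqP/negPf nb].
  by congr (_ - _); apply: eq_bigr => j _; rewrite !mxE eqxx.
by congr (_ - _); apply: eq_bigr => j _; rewrite !mxE nb.
Qed.

Lemma Berstar_cramer r s (G : 'M[A]_(r + s)) (w c : 'cV_(r + s)) j :
  even_supermx G -> invertible (\det (ulsubmx G)) -> G *m w = c ->
  Berstar (set_col G (rshift r j) c) = Berstar G * w (rshift r j) 0.
Proof.
move=> eG i1 Gw; pose sw (d : 'cV[A]_(r + s)) := col_mx (dsubmx d) (usubmx d).
have -> : w (rshift r j) 0 = sw w (lshift r j) 0 by rewrite col_mxEu mxE.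
rewrite /Berstar -!/(swapmx _) -(@Ber_cramer _ _ _ _ (sw c)).
- congr (Ber _); apply/matrixP => a b; rewrite [RHS]mxE /sw /swapmx.
  rewrite -(splitK a) -(splitK b); case: (split a) => a'; case: (split b) => b' /=;
  rewrite ?block_mxEul ?block_mxEur ?block_mxEdl ?block_mxEdr ?col_mxEu ?col_mxEd !mxE;
  by rewrite ?(inj_eq (@lshift_inj _ _)) ?(inj_eq (@rshift_inj _ _)) ?eq_lrshift ?eq_rlshift.
- exact: even_supermx_swap.
- by rewrite block_mxKdr.
rewrite -Gw /sw -mul_usub_mx -mul_dsub_mx mul_block_col.
have e n (x : 'M[A]_(n, r + s)) : x *m w = rsubmx x *m dsubmx w + lsubmx x *m usubmx w.
  by rewrite -{1}[x]hsubmxK -{1}[w]vsubmxK mul_row_col addrC.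
by rewrite !e.
Qed.

End Berezinian.

(** * Evaluation of functions *)

Section MapBer.
Variables (k : numFieldType) (A B : superalg k) (phi : {rmorphism A -> B}).

Lemma rmorph_is_inverse (x y : A) : is_inverse x y -> is_inverse (phi x) (phi y).
Proof. by case=> xy yx; split; rewrite -rmorphM ?xy ?yx rmorph1. Qed.

Lemma rmorph_inverse (x : A) : invertible x -> phi (inverse x) = inverse (phi x).
Proof. by move=> /inverseP/rmorph_is_inverse/inverseE. Qed.

(** Invertibility ensures that the chosen inverses are genuine, hence preserved by a ring morphism;
    the default value 0 need not correspond to the default value on the other side. *)
Lemma map_Ber r s (G : 'M[A]_(r + s)) :
  grmx false (drsubmx G) -> invertible (\det (drsubmx G)) ->
  phi (Ber G) = Ber (map_mx phi G).
Proof.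
move=> e4 i4; have [eT GT TG] := inverse_mxP e4 i4.
have iE : inverse_mx (drsubmx (map_mx phi G)) = map_mx phi (inverse_mx (drsubmx G)).
  by apply: inverse_mxE; rewrite -map_drsubmx -map_mxM ?GT ?TG map_mx1.
rewrite /Ber iE rmorphM (rmorph_inverse i4) -!det_map_mx map_mxB !map_mxM.
by rewrite map_ulsubmx map_ursubmx map_dlsubmx map_drsubmx.
Qed.

Lemma map_Berstar r s (G : 'M[A]_(r + s)) :
  grmx false (ulsubmx G) -> invertible (\det (ulsubmx G)) ->
  phi (Berstar G) = Berstar (map_mx phi G).
Proof.
move=> e1 i1; rewrite /Berstar map_Ber ?block_mxKdr // map_block_mx.
by rewrite map_ulsubmx map_ursubmx map_dlsubmx map_drsubmx.
Qed.

End MapBer.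

(** * Square supermatrices of selected columns, and stability of [Mtilde] under [SL] *)

Section SelectCols.
Variables (k : numFieldType) (r s p q : nat).

(* The analogue of [pick_cols] at any matrix: [pick_cols c d] is convertible to
   [select_cols c d coord_mx]. *)
Definition select_cols (R : Type) (c : 'I_r -> 'I_(p + q)) (d : 'I_s -> 'I_(p + q))
    (M : 'M[R]_(r + s, p + q)) : 'M[R]_(r + s) :=
  row_mx (colsub c M) (colsub d M).

Lemma mulmx_select (R : pzRingType) (g : 'M[R]_(r + s)) c d M :
  g *m select_cols c d M = select_cols c d (g *m M).
Proof. by rewrite mul_mx_row !mulmx_colsub. Qed.

Lemma map_select (R S : Type) (f : R -> S) c d (M : 'M[R]_(r + s, p + q)) :
  map_mx f (select_cols c d M) = select_cols c d (map_mx f M).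
Proof. by rewrite map_row_mx; congr row_mx; apply/matrixP => i j; rewrite !mxE. Qed.

Lemma ulsubmx_select (R : Type) c d (M : 'M[R]_(r + s, p + q)) :
  ulsubmx (select_cols (fun a => lshift q (c a)) d M) = colsub c (ulsubmx M).
Proof. by apply/matrixP => i j; rewrite 2!mxE row_mxEl !mxE. Qed.

Lemma dlsubmx_select (R : Type) c d (M : 'M[R]_(r + s, p + q)) :
  dlsubmx (select_cols (fun a => lshift q (c a)) d M) = colsub c (dlsubmx M).
Proof. by apply/matrixP => i j; rewrite 2!mxE row_mxEl !mxE. Qed.

Lemma ursubmx_select (R : Type) c d (M : 'M[R]_(r + s, p + q)) :
  ursubmx (select_cols c (fun b => rshift p (d b)) M) = colsub d (ursubmx M).
Proof. by apply/matrixP => i j; rewrite 2!mxE row_mxEr !mxE. Qed.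

Lemma drsubmx_select (R : Type) c d (M : 'M[R]_(r + s, p + q)) :
  drsubmx (select_cols c (fun b => rshift p (d b)) M) = colsub d (drsubmx M).
Proof. by apply/matrixP => i j; rewrite 2!mxE row_mxEr !mxE. Qed.

Lemma select_replace_left (R : Type) c d a j (M : 'M[R]_(r + s, p + q)) :
  select_cols (replace_col c a j) d M = set_col (select_cols c d M) (lshift s a) (col j M).
Proof.
apply/matrixP => x y; rewrite [RHS]mxE -(splitK y).
case: (split y) => y' /=; rewrite ?row_mxEl ?row_mxEr !mxE.
  by rewrite (inj_eq (@lshift_inj _ _)) /replace_col; case: eqP.
by rewrite eq_rlshift.
Qed.

Lemma select_replace_right (R : Type) c d b j (M : 'M[R]_(r + s, p + q)) :
  select_cols c (replace_col d b j) M = set_col (select_cols c d M) (rshift r b) (col j M).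
Proof.
apply/matrixP => x y; rewrite [RHS]mxE -(splitK y).
case: (split y) => y' /=; rewrite ?row_mxEl ?row_mxEr !mxE.
  by rewrite eq_lrshift.
by rewrite (inj_eq (@rshift_inj _ _)) /replace_col; case: eqP.
Qed.

Variable A : superalg k.

Lemma grmx_colsub b m n n' (c : 'I_n' -> 'I_n) (M : 'M[A]_(m, n)) :
  grmx b M -> grmx b (colsub c M).
Proof. by move=> gM i j; rewrite mxE. Qed.

Lemma Mtilde_select_unit (I : increasing r p) (J : increasing s q)
    (M : 'M[A]_(r + s, p + q)) :
  Mtilde M -> supermx_unit (select_cols (even_cols q I) (odd_cols p J) M).
Proof.
case=> [[e1 o2 o3 e4] iI iJ]; split; [split| |];
  rewrite ?ulsubmx_select ?ursubmx_select ?dlsubmx_select ?drsubmx_select //;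
  exact: grmx_colsub.
Qed.

Lemma SL_unit (g : 'M[A]_(r + s)) : SL g -> supermx_unit g.
Proof. by case=> eg [h [eh gh hg]] _; apply: supermx_unitP gh. Qed.

Hypotheses (rp : (r <= p)%N) (sq : (s <= q)%N).

Lemma initial_increasing m n (mn : (m <= n)%N) :
  [forall a : 'I_m, forall b : 'I_m, (a < b)%N ==>
    ([ffun i => widen_ord mn i] a < [ffun i => widen_ord mn i] b)%N].
Proof. by apply/'forall_'forall_implyP => a b ab; rewrite !ffunE. Qed.

Definition initial m n (mn : (m <= n)%N) : increasing m n :=
  exist _ [ffun i => widen_ord mn i] (initial_increasing mn).

(** A minor of a diagonal block of [g M] is the determinant of a diagonal block of [g] times a
    square selection of columns of [M]. The bounds [rp] and [sq] allow the chosen even or odd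
    columns to be completed by initial columns of the other parity. *)
Lemma Mtilde_mul (g : 'M[A]_(r + s)) (M : 'M_(r + s, p + q)) :
  SL g -> Mtilde M -> Mtilde (g *m M).
Proof.
move=> /SL_unit ug hM.
have key I J := supermx_unit_mul ug (@Mtilde_select_unit I J _ hM).
split.
- by case: ug hM => eg _ _ [eM _ _]; apply: even_supermx_mul.
- move=> I; have [_ + _] := key I (initial sq).
  by rewrite mulmx_select ulsubmx_select.
- move=> J; have [_ _] := key (initial rp) J.
  by rewrite mulmx_select drsubmx_select.
Qed.

End SelectCols.

Section Evaluation.
Variables (k : numFieldType) (r s p q : nat).
Local Notation O := (Otilde k r s p q).
Variable (A : superalg k).
Implicit Type M : 'M[A]_(r + s, p + q).

Lemma Oeval_pi M t : Mtilde M -> Oeval M (Opi t : O) = feval M t.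
Proof. by move=> hM; apply: feval_fteq => //; apply: repr_Opi. Qed.

(** Evaluation respects the relations of the presentation only on [Mtilde], so the morphism
    structure depends on the proof of [Mtilde M] and is provided existentially. *)
Lemma Oeval_rmorph M : Mtilde M ->
  exists phi : {rmorphism O -> A}, phi =1 @Oeval k r s p q A M.
Proof.
move=> hM; pose f : O -> A := @Oeval k r s p q A M.
have fB : zmod_morphism f.
  move=> x y; rewrite /f; elim/Ofun_ind: x => t; elim/Ofun_ind: y => u.
  by rewrite -OpiN -OpiD !Oeval_pi.
have fM : monoid_morphism f.
  split=> [|x y]; first by rewrite /f -[1]/(Opi _) Oeval_pi.
  rewrite /f; elim/Ofun_ind: x => t; elim/Ofun_ind: y => u.
  by rewrite -OpiM !Oeval_pi.
pose fBM := GRing.isZmodMorphism.Build _ _ f fB.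
pose fMM := GRing.isMonoidMorphism.Build _ _ f fM.
pose phi : {rmorphism O -> A} := HB.pack f fBM fMM.
by exists phi.
Qed.

Lemma OevalZ M c (f : O) : Mtilde M -> Oeval M (c *: f) = c *: Oeval M f.
Proof. by elim/Ofun_ind: f => t hM; rewrite -OpiZ !Oeval_pi. Qed.

Lemma feval_gen_grade M g : Mtilde M -> grade A (fpar g) (feval_gen M g).
Proof.
case=> [[e1 o2 o3 e4] iI iJ]; case: g => //= I.
  by apply: grade_inverse => //; apply: grade_det => i j; rewrite mxE.
by apply: grade_inverse => //; apply: grade_det => i j; rewrite mxE.
Qed.

Lemma Oeval_grade M b (f : O) : Mtilde M -> grade O b f -> grade A b (Oeval M f).
Proof.
move=> hM; have [phi phiE] := Oeval_rmorph hM.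
elim=> {b f} [g|b||b x y _ e _ e'|b c x _ e|b c x y _ e _ e'].
- by rewrite /Ogen Oeval_pi //; apply: feval_gen_grade.
- by rewrite -phiE rmorph0; apply: grade0.
- by rewrite -phiE rmorph1; apply: grade1.
- by rewrite -phiE rmorphD !phiE; apply: gradeD.
- by rewrite OevalZ //; apply: gradeZ.
- by rewrite -phiE rmorphM !phiE; apply: gradeM.
Qed.

Lemma Oeval_coord M : Mtilde M ->
  map_mx (@Oeval k r s p q A M) (coord_mx k r s p q) = M.
Proof.
move=> hM; rewrite map_block_mx -[RHS]submxK.
by congr block_mx; apply/matrixP => i j; rewrite !mxE /Ogen Oeval_pi //= !mxE.
Qed.

End Evaluation.

(** * The coordinate matrix as a universal point *)

Section Universal.
Variables (k : numFieldType) (r s p q : nat).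
Local Notation O := (Otilde k r s p q).
Local Notation coord := (coord_mx k r s p q).

Lemma Opi_det n (X : 'I_n -> 'I_n -> fterm k r s p q) :
  (Opi (fdet X) : O) = \det (\matrix_(i, j) (Opi (X i j) : O)).
Proof.
rewrite /fdet (big_morph (@Opi k r s p q) (id1 := 0) (op1 := +%R)) //; last exact: OpiD.
apply: eq_bigr => w _ /=; rewrite OpiZ scaler_sign mulr_sign.
rewrite (big_morph (@Opi k r s p q) (id1 := 1) (op1 := *%R)) //; last exact: OpiM.
by under [in RHS]eq_bigr do rewrite mxE.
Qed.

Lemma even_coord : even_supermx coord.
Proof.
split=> i j; rewrite ?block_mxKul ?block_mxKur ?block_mxKdl ?block_mxKdr mxE.
- exact: (Ograde_gen k (GenX s q i j)).
- exact: (Ograde_gen k (GenAlpha s p i j)).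
- exact: (Ograde_gen k (GenBeta r q i j)).
- exact: (Ograde_gen k (GenY r p i j)).
Qed.

Lemma coord_minorX (I : increasing r p) :
  is_inverse (\det (colsub (sval I) (ulsubmx coord)))
    (Ogen k (GenInvX s q I) : O).
Proof.
apply: even_is_inverse.
  by apply: grade_det => i j; rewrite mxE; case: even_coord.
transitivity (Opi (FOne k r s p q) : O) => //.
transitivity (Opi (FMul (fdetX k s q I) (FGen k (GenInvX s q I))) : O).
  rewrite OpiM Opi_det block_mxKul; congr (\det _ * _).
  by apply/matrixP => i j; rewrite !mxE.
exact/OpiP/fteq_invX.
Qed.

Lemma coord_minorY (J : increasing s q) :
  is_inverse (\det (colsub (sval J) (drsubmx coord)))
    (Ogen k (GenInvY r p J) : O).
Proof.
apply: even_is_inverse.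
  by apply: grade_det => i j; rewrite mxE; case: even_coord.
transitivity (Opi (FOne k r s p q) : O) => //.
transitivity (Opi (FMul (fdetY k r p J) (FGen k (GenInvY r p J))) : O).
  rewrite OpiM Opi_det block_mxKdr; congr (\det _ * _).
  by apply/matrixP => i j; rewrite !mxE.
exact/OpiP/fteq_invY.
Qed.

Lemma coord_Mtilde : Mtilde coord.
Proof.
split; first exact: even_coord.
- by move=> I; exists (Ogen k (GenInvX s q I)); apply: coord_minorX.
- by move=> J; exists (Ogen k (GenInvY r p J)); apply: coord_minorY.
Qed.

(** Inverses are unique, so the inverse chosen for a minor of [coord] is the formal generator
    adjoined for it; hence evaluation at [coord] is the quotient map. *)
Lemma feval_coord t : feval coord t = (Opi t : O).
Proof.
elim: t => [g|||t IH|t IHt u IHu|t IHt u IHu|c t IH] /=.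
- case: g => [i j|i j|i j|i j|I|J] /=.
  + by rewrite block_mxKul mxE.
  + by rewrite block_mxKdr mxE.
  + by rewrite block_mxKur mxE.
  + by rewrite block_mxKdl mxE.
  + exact: inverseE (coord_minorX I).
  + exact: inverseE (coord_minorY J).
- by [].
- by [].
- by rewrite IH OpiN.
- by rewrite IHt IHu OpiD.
- by rewrite IHt IHu OpiM.
- by rewrite IH OpiZ.
Qed.

End Universal.

(** * Invariance of the super minors *)

(** The values of [c] are sorted. This is needed because replacing a column in an increasing
    selection usually destroys the order, while super minors are indexed by increasing
    selections. *)
Lemma increasing_of_injective r p (c : 'I_r -> 'I_p) : injective c ->
  exists (I : increasing r p) (w : 'S_r), forall a, c a = sval I (w a).
Proof.
move=> inj_c; pose le (x y : 'I_p) := (x <= y)%N.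
pose t := [tuple c i | i < r]; pose u := sort le t.
have /tuple_permP[w uE] : perm_eq u t by rewrite perm_sort.
have szu : size u = r by rewrite size_sort size_tuple.
have nthu i (a : 'I_r) : nth i u a = c (w a).
  by rewrite uE -tnth_nth !tnth_mktuple.
have u_sorted : sorted le u by apply: sort_sorted => x y; apply: leq_total.
have incr : [forall a : 'I_r, forall b : 'I_r, (a < b)%N ==>
    ([ffun i => c (w i)] a < [ffun i => c (w i)] b)%N].
  apply/'forall_'forall_implyP => a b ab; rewrite !ffunE ltn_neqAle.
  rewrite (inj_eq val_inj) (inj_eq inj_c) (inj_eq perm_inj) -(inj_eq val_inj) ltn_eqF //=.
  rewrite -(nthu (c a)) -(nthu (c a)).
  apply: (sorted_ltn_nth _ _ u_sorted) => //; rewrite ?inE ?szu //.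
  by move=> x y z; apply: leq_trans.
exists (exist _ [ffun i => c (w i)] incr), (w^-1)%g => a /=.
by rewrite ffunE permKV.
Qed.

Lemma colsub_perm (R : pzRingType) m r p (c d : 'I_r -> 'I_p) (w : 'S_r)
    (M : 'M[R]_(m, p)) :
  (forall a, c a = d (w a)) -> colsub c M = colsub d M *m perm_mx w^-1.
Proof.
by move=> cE; rewrite -col_permE; apply/matrixP => i j; rewrite !mxE cE.
Qed.

Lemma Ber_perm (k : numFieldType) (A : superalg k) r s
    (B C : 'M[A]_(r + s)) (w : 'S_r) :
  supermx_unit B ->
  ulsubmx C = ulsubmx B *m perm_mx w -> dlsubmx C = dlsubmx B *m perm_mx w ->
  ursubmx C = ursubmx B -> drsubmx C = drsubmx B ->
  Ber C = Ber B * (-1) ^+ w.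
Proof.
move=> [[e1 o2 o3 e4] _ i4] C1 C3 C2 C4; have [eT _ _] := inverse_mxP e4 i4.
rewrite /Ber C1 C2 C3 C4 !mulmxA -mulmxBl even_det_mulmx.
- by rewrite superalg_det_perm mulrA.
- by apply: grmxB => //; apply: odd_mul_even o3; apply: (grmx_mul o2 eT).
- by move=> i j; rewrite !mxE; case: eqP => _; [apply: grade1|apply: grade0].
Qed.

Section Sorting.
Variables (k : numFieldType) (A : superalg k) (r s p q : nat).

Lemma Ber_select_sort (I : increasing r p) (J : increasing s q)
    (c : 'I_r -> 'I_p) (w : 'S_r)
    (M : 'M[A]_(r + s, p + q)) : Mtilde M -> (forall a, c a = sval I (w a)) ->
  Ber (select_cols (fun a : 'I_r => lshift q (c a)) (odd_cols p J) M) =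
  Ber (select_cols (even_cols q I) (odd_cols p J) M) * (-1) ^+ w.
Proof.
(* [colsub_perm] produces the matrix of the inverse permutation, which has the same sign. *)
move=> hM cE; rewrite -odd_permV; apply: Ber_perm; first exact: Mtilde_select_unit.
- by rewrite !ulsubmx_select; apply: colsub_perm.
- by rewrite !dlsubmx_select; apply: colsub_perm.
- by rewrite !ursubmx_select.
- by rewrite !drsubmx_select.
Qed.

Lemma Berstar_select_sort (I : increasing r p) (J : increasing s q)
    (d : 'I_s -> 'I_q) (w : 'S_s)
    (M : 'M[A]_(r + s, p + q)) : Mtilde M -> (forall b, d b = sval J (w b)) ->
  Berstar (select_cols (even_cols q I) (fun b => rshift p (d b)) M) =
  Berstar (select_cols (even_cols q I) (odd_cols p J) M) * (-1) ^+ w.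
Proof.
move=> hM dE; rewrite -odd_permV /Berstar.
have u := supermx_unit_swap (Mtilde_select_unit I J hM).
by apply: (Ber_perm u); rewrite /swapmx ?block_mxKul ?block_mxKur ?block_mxKdl ?block_mxKdr;
   rewrite ?ulsubmx_select ?dlsubmx_select ?ursubmx_select ?drsubmx_select //; apply: colsub_perm.
Qed.

End Sorting.

Section Invariance.
Variables (k : numFieldType) (r s p q : nat).
Hypotheses (rp : (r <= p)%N) (sq : (s <= q)%N).
Local Notation O := (Otilde k r s p q).
Local Notation coord := (coord_mx k r s p q).

(** The even positions carry arbitrary columns [c], so fake minors are included; only the odd
    positions enter the block that has to be inverted. *)
Lemma Oeval_Ber (A : superalg k) (M : 'M[A]_(r + s, p + q)) c (J : increasing s q) :
  Mtilde M -> Oeval M (Ber (select_cols c (odd_cols p J) coord) : O) =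
  Ber (select_cols c (odd_cols p J) M).
Proof.
move=> hM; have [phi phiE] := Oeval_rmorph hM.
have [[_ _ _ e4] _ iJ] := coord_Mtilde k r s p q.
have eJ : grmx false (drsubmx (select_cols c (odd_cols p J) coord)).
  by rewrite drsubmx_select; apply: grmx_colsub.
have iJ' : invertible (\det (drsubmx (select_cols c (odd_cols p J) coord))).
  by rewrite drsubmx_select; apply: iJ.
rewrite -phiE (map_Ber phi eJ iJ') map_select; congr (Ber (select_cols _ _ _));
rewrite -[RHS](Oeval_coord hM).
by apply/matrixP => i j; rewrite mxE [RHS]mxE phiE.
Qed.

Lemma Oeval_Berstar (A : superalg k) (M : 'M[A]_(r + s, p + q)) (I : increasing r p) d :
  Mtilde M -> Oeval M (Berstar (select_cols (even_cols q I) d coord) : O) =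
  Berstar (select_cols (even_cols q I) d M).
Proof.
move=> hM; have [phi phiE] := Oeval_rmorph hM.
have [[e1 _ _ _] iI _] := coord_Mtilde k r s p q.
have eI : grmx false (ulsubmx (select_cols (even_cols q I) d coord)).
  by rewrite ulsubmx_select; apply: grmx_colsub.
have iI' : invertible (\det (ulsubmx (select_cols (even_cols q I) d coord))).
  by rewrite ulsubmx_select; apply: iI.
rewrite -phiE (map_Berstar phi eI iI') map_select; congr (Berstar (select_cols _ _ _));
rewrite -[RHS](Oeval_coord hM).
by apply/matrixP => i j; rewrite mxE [RHS]mxE phiE.
Qed.

(* By Cramer's rule a (fake) minor is [Ber G] times an entry of the solution [w]
   of [G *m w = c]; this solution also satisfies [(g *m G) *m w = g *m c]. *)
Lemma super_minors_invariant : (super_minors k r s p q `<=` SL_invariants k r s p q)%classic.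
Proof.
move=> _ [] I J.
- move=> A g M hg hM; have hgM := Mtilde_mul rp sq hg hM.
  rewrite (Oeval_Ber _ _ hgM) (Oeval_Ber _ _ hM) -mulmx_select.
  rewrite (Ber_mul (SL_unit hg) (Mtilde_select_unit I J hM)).
  by case: hg => _ _ ->; rewrite mul1r.
- move=> A g M hg hM; have hgM := Mtilde_mul rp sq hg hM.
  rewrite (Oeval_Berstar _ _ hgM) (Oeval_Berstar _ _ hM) -mulmx_select.
  by apply: (Berstar_mul (SL_unit hg) (Mtilde_select_unit I J hM)); case: hg.
- move=> a lam A g M hg hM; have hgM := Mtilde_mul rp sq hg hM.
  rewrite (Oeval_Ber _ _ hgM) (Oeval_Ber _ _ hM) !select_replace_left -mulmx_select.
  have uG := Mtilde_select_unit I J hM; have ug := SL_unit hg.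
  have [H [_ GH _]] := supermx_unit_inverse uG.
  have [eG _ iG] := uG; have [egG _ igG] := supermx_unit_mul ug uG.
  set c := col (rshift p lam) M; set G := select_cols _ _ M in uG GH eG iG egG igG *.
  have Gw : G *m (H *m c) = c by rewrite mulmxA GH mul1mx.
  have gGw : g *m G *m (H *m c) = col (rshift p lam) (g *m M).
    by rewrite -mulmxA Gw /c !colE mulmxA.
  rewrite (Ber_cramer a eG iG Gw) (Ber_cramer a egG igG gGw) (Ber_mul ug uG).
  by case: hg => _ _ ->; rewrite mul1r.
- move=> b m A g M hg hM; have hgM := Mtilde_mul rp sq hg hM.
  rewrite (Oeval_Berstar _ _ hgM) (Oeval_Berstar _ _ hM) !select_replace_right -mulmx_select.
  have uG := Mtilde_select_unit I J hM; have ug := SL_unit hg.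
  have [H [_ GH _]] := supermx_unit_inverse uG.
  have [eG iG _] := uG; have [egG igG _] := supermx_unit_mul ug uG.
  set c := col (lshift q m) M; set G := select_cols _ _ M in uG GH eG iG egG igG *.
  have Gw : G *m (H *m c) = c by rewrite mulmxA GH mul1mx.
  have gGw : g *m G *m (H *m c) = col (lshift q m) (g *m M).
    by rewrite -mulmxA Gw /c !colE mulmxA.
  rewrite (Berstar_cramer b eG iG Gw) (Berstar_cramer b egG igG gGw).
  by rewrite (Berstar_mul ug uG) //; case: hg.
Qed.

Lemma SL_invariants_subsuperalg : subsuperalg (SL_invariants k r s p q).
Proof.
split.
- move=> A g M hg hM; have hgM := Mtilde_mul rp sq hg hM.
  have [phi phiE] := Oeval_rmorph hM; have [psi psiE] := Oeval_rmorph hgM.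
  by rewrite -phiE -psiE !rmorph1.
- move=> x y hx hy A g M hg hM; have hgM := Mtilde_mul rp sq hg hM.
  have [phi phiE] := Oeval_rmorph hM; have [psi psiE] := Oeval_rmorph hgM.
  by rewrite -phiE -psiE !rmorphD !phiE !psiE hx // hy.
- move=> c x hx A g M hg hM; have hgM := Mtilde_mul rp sq hg hM.
  by rewrite !OevalZ // hx.
- move=> x y hx hy A g M hg hM; have hgM := Mtilde_mul rp sq hg hM.
  have [phi phiE] := Oeval_rmorph hM; have [psi psiE] := Oeval_rmorph hgM.
  by rewrite -phiE -psiE !rmorphM !phiE !psiE hx // hy.
move=> x0 x1 ev od hx.
have key A g M : SL g -> Mtilde M ->
    Oeval (g *m M) x0 = Oeval M x0 /\ Oeval (g *m M) x1 = @Oeval k r s p q A M x1.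
  move=> hg hM; have hgM := Mtilde_mul rp sq hg hM.
  have [phi phiE] := Oeval_rmorph hM; have [psi psiE] := Oeval_rmorph hgM.
  have := hx A g M hg hM; rewrite -phiE -psiE !rmorphD !phiE !psiE.
  have e0 := gradeB (Oeval_grade hgM ev) (Oeval_grade hM ev).
  have o1 := gradeB (Oeval_grade hM od) (Oeval_grade hgM od).
  (* The left side of [e'] is even and the right side is odd, so both vanish. *)
  move=> e; have e' : Oeval (g *m M) x0 - Oeval M x0 = Oeval M x1 - Oeval (g *m M) x1.
    rewrite -[Oeval _ x0 in LHS](addrK (Oeval (g *m M) x1)) e addrAC.
    by rewrite [Oeval M x0 + _]addrC addrK.
  have d0 := e0; rewrite e' in d0; have z := grade_disj d0 o1.
  by split; apply: subr0_eq; [rewrite e' z|rewrite -opprB z oppr0].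
by split=> A g M hg hM; case: (key A g M hg hM).
Qed.

End Invariance.

(** * Generation *)

Section Blocks.
Variables (T : Type) (m n m' n' : nat).
Implicit Types B C : 'M[T]_(m + n, m' + n').

Lemma right_blocks B C :
  rsubmx B = rsubmx C -> ursubmx B = ursubmx C /\ drsubmx B = drsubmx C.
Proof.
move=> /matrixP e; split; apply/matrixP => i j.
  by have := e (lshift n i) j; rewrite !mxE.
by have := e (rshift m i) j; rewrite !mxE.
Qed.

Lemma left_blocks B C :
  lsubmx B = lsubmx C -> ulsubmx B = ulsubmx C /\ dlsubmx B = dlsubmx C.
Proof.
move=> /matrixP e; split; apply/matrixP => i j.
  by have := e (lshift n i) j; rewrite !mxE.
by have := e (rshift m i) j; rewrite !mxE.
Qed.

End Blocks.

Section BlockBer.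
Variables (k : numFieldType) (A : superalg k) (r s : nat).

Lemma Ber_ul (B : 'M[A]_(r + s)) :
  ursubmx B = 0 -> drsubmx B = 1%:M -> Ber B = \det (ulsubmx B).
Proof.
by move=> B2 B4; rewrite /Ber B2 B4 !mul0mx subr0 superalg_det1 inverse1 mul1r.
Qed.

Lemma Ber1 : Ber (1%:M : 'M[A]_(r + s)) = 1.
Proof.
by rewrite Ber_ul scalar_mx_block ?block_mxKul ?block_mxKur ?block_mxKdr ?superalg_det1.
Qed.

Lemma Berstar_dr (B : 'M[A]_(r + s)) :
  dlsubmx B = 0 -> Berstar B = inverse (\det (ulsubmx B)) * \det (drsubmx B).
Proof.
move=> B3; rewrite /Berstar /Ber block_mxKul block_mxKur block_mxKdl block_mxKdr.
by rewrite B3 !mul0mx subr0.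
Qed.

(** Written through [set_col] so that its determinant is Cramer's rule for the identity matrix,
    whatever the parity of [x]. *)
Definition dilation (i : 'I_r) (x : A) : 'M[A]_r :=
  set_col 1%:M i (\col_a (if a == i then x else 0)).

Lemma det_dilation i x : \det (dilation i x) = x.
Proof.
rewrite (even_det_cramer _ (@grmx1 _ A r) (mul1mx _)) superalg_det1 mul1r.
by rewrite mxE eqxx.
Qed.

Lemma even_dilation i x : grade A false x -> grmx false (dilation i x).
Proof.
move=> ex a b; rewrite !mxE; case: (b == i); case: eqP => _ //;
  by [apply: grade0|apply: grade1].
Qed.

End BlockBer.

Section Generation.
Variables (k : numFieldType) (r s p q : nat).
Hypothesis r0 : (0 < r)%N.
Local Notation O := (Otilde k r s p q).
Local Notation coord := (coord_mx k r s p q).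
Variable S : set O.
Hypotheses (subS : subsuperalg S) (minS : (super_minors k r s p q `<=` S)%classic).

Let S1 : S 1. Proof. by case: subS. Qed.
Let SD x y : S x -> S y -> S (x + y). Proof. by case: subS => _ + _ _ _; apply. Qed.
Let SZ c x : S x -> S (c *: x). Proof. by case: subS => _ _ + _ _; apply. Qed.
Let SM x y : S x -> S y -> S (x * y). Proof. by case: subS => _ _ _ + _; apply. Qed.
Let S0 : S 0. Proof. by rewrite -(scale0r 1); apply: SZ. Qed.
Let SN x : S x -> S (- x). Proof. by rewrite -scaleN1r; apply: SZ. Qed.
Let Ssign x (b : bool) : S x -> S (x * (-1) ^+ b).
Proof. by case: b => /= Sx; rewrite ?expr1 ?mulrN1 ?mulr1 //; apply: SN. Qed.

Definition all_entries m n (M : 'M[O]_(m, n)) := forall i j, S (M i j).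

Lemma all_entries_mul m n l (M : 'M_(m, n)) (N : 'M_(n, l)) :
  all_entries M -> all_entries N -> all_entries (M *m N).
Proof.
move=> SMM SNN i j; rewrite mxE.
by apply: (big_ind S) => // a _; apply: SM.
Qed.

Lemma all_entries1 n : all_entries (1%:M : 'M_n).
Proof. by move=> i j; rewrite mxE; case: eqP. Qed.

Lemma Ber_even_cols (c : 'I_r -> 'I_p) (J : increasing s q) : injective c ->
  S (Ber (select_cols (fun a => lshift q (c a)) (odd_cols p J) coord)).
Proof.
move=> /increasing_of_injective[I [w cE]].
rewrite (Ber_select_sort J (coord_Mtilde k r s p q) cE).
by apply/Ssign/minS/minor.
Qed.

Lemma Berstar_odd_cols (I : increasing r p) (d : 'I_s -> 'I_q) : injective d ->
  S (Berstar (select_cols (even_cols q I) (fun b => rshift p (d b)) coord)).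
Proof.
move=> /increasing_of_injective[J [w dE]].
rewrite (Berstar_select_sort I (coord_Mtilde k r s p q) dE).
by apply/Ssign/minS/minor_star.
Qed.

Lemma increasing_inj m n (I : increasing m n) : injective (sval I).
Proof.
move=> a b e; apply/val_inj/eqP; have /forallP incr := svalP I.
by case: ltngtP => // ab; [have /forallP/(_ b) := incr a|have /forallP/(_ a) := incr b];
  rewrite ab e ltnn.
Qed.

Lemma replace_inj m n (I : increasing m n) a j : (forall b, sval I b <> j) ->
  injective (fun b => if b == a then j else sval I b).
Proof.
move=> nj b c; case: eqP => [->|_]; case: eqP => [->|_] //.
- by move=> /esym /nj.
- by move=> /nj.
- exact: increasing_inj.
Qed.

Variables (I0 : increasing r p) (J0 : increasing s q).
Local Notation G := (select_cols (even_cols q I0) (odd_cols p J0) coord).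
Variable H : 'M[O]_(r + s).
Hypotheses (uH : supermx_unit H) (GH : G *m H = 1%:M) (HG : H *m G = 1%:M).

Let uG : supermx_unit G. Proof. exact: Mtilde_select_unit (coord_Mtilde _ _ _ _ _). Qed.
Let BerG : is_inverse (Ber G) (Berstar G). Proof. exact: Ber_is_inverse. Qed.
Let SBer : S (Ber G). Proof. by apply/minS/minor. Qed.
Let SBerstar : S (Berstar G). Proof. by apply/minS/minor_star. Qed.

Lemma mul_col_entry i j : (H *m col j coord) i 0 = (H *m coord) i j.
Proof. by rewrite !mxE; apply: eq_bigr => l _; rewrite mxE. Qed.

(** Column [j] of [H *m coord] solves a linear system with matrix [G]. By Cramer's rule its entries
    are [Berstar G] times a [Ber] in even rows, and [Ber G] times a [Berstar] in odd rows, with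
    column [j] put into [G]. A column of the opposite parity gives a fake minor, and a new column of
    the same parity gives a minor up to sign. *)
Lemma all_entries_HA : all_entries (H *m coord).
Proof.
have HGE i j : (H *m coord) i (even_cols q I0 j) = (1%:M : 'M[O]_(r + s)) i (lshift s j).
  by rewrite -HG mulmx_select row_mxEl [RHS]mxE.
have HGO i j : (H *m coord) i (odd_cols p J0 j) = (1%:M : 'M[O]_(r + s)) i (rshift r j).
  by rewrite -HG mulmx_select row_mxEr [RHS]mxE.
have Gcol j : G *m (H *m col j coord) = col j coord by rewrite mulmxA GH mul1mx.
have [eG iG1 iG4] := uG.
move=> i j; rewrite -(splitK i); case: (split i) => a /=.
- have NE : (H *m coord) (lshift s a) j =
      Berstar G * Ber (select_cols (replace_col (even_cols q I0) a j) (odd_cols p J0) coord).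
    rewrite select_replace_left (Ber_cramer a eG iG4 (Gcol j)) mulrA BerG.2 mul1r.
    by rewrite mul_col_entry.
  move: NE; rewrite -(splitK j); case: (split j) => b /= NE; last first.
    by rewrite NE; apply: (SM SBerstar); apply/minS/fake_minor.
  (* A column already in [G] could be repeated by the replacement and then yields no increasing
     selection; its entry is read off [H *m G = 1] instead. *)
  have [[b' <-]|nb] := pselect (exists b', sval I0 b' = b).
    by rewrite HGE; apply: all_entries1.
  have inj := @replace_inj _ _ I0 a b (fun b' e => nb (ex_intro _ b' e)).
  have cE : replace_col (even_cols q I0) a (lshift q b) =
      fun b' => lshift q (if b' == a then b else sval I0 b').
    by apply/funext => b'; rewrite /replace_col; case: eqP.
  by rewrite NE cE; apply: (SM SBerstar); apply: (Ber_even_cols J0 inj).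
- have NE : (H *m coord) (rshift r a) j =
      Ber G * Berstar (select_cols (even_cols q I0) (replace_col (odd_cols p J0) a j) coord).
    rewrite select_replace_right (Berstar_cramer a eG iG1 (Gcol j)) mulrA BerG.1 mul1r.
    by rewrite mul_col_entry.
  move: NE; rewrite -(splitK j); case: (split j) => b /= NE.
    by rewrite NE; apply: (SM SBer); apply/minS/fake_minor_star.
  have [[b' <-]|nb] := pselect (exists b', sval J0 b' = b).
    by rewrite HGO; apply: all_entries1.
  have inj := @replace_inj _ _ J0 a b (fun b' e => nb (ex_intro _ b' e)).
  have dE : replace_col (odd_cols p J0) a (rshift p b) =
      fun b' => rshift p (if b' == a then b else sval J0 b').
    by apply/funext => b'; rewrite /replace_col; case: eqP.
  by rewrite NE dE; apply: (SM SBer); apply: (Berstar_odd_cols I0 inj).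
Qed.

Definition normalizer_dilation : 'M[O]_(r + s) :=
  block_mx (dilation (Ordinal r0) (Ber G)) 0 0 1%:M.
Local Notation D := normalizer_dilation.

Lemma normalizer_unit : supermx_unit D.
Proof.
apply: supermx_unit_block; try exact: grmx0; try exact: grmx1.
- exact/even_dilation/even_Ber.
- by rewrite det_dilation; exists (Berstar G).
- by rewrite superalg_det1; apply: invertible1.
Qed.

Lemma normalizer_SL : SL (D *m H).
Proof.
have uDH := supermx_unit_mul normalizer_unit uH.
have [C [[eC _ _] DC CD]] := supermx_unit_inverse uDH.
split; [by case: uDH|by exists C|].
rewrite Ber_diag //; first last.
- by rewrite superalg_det1; apply: invertible1.
- exact: grmx1.
- exact/even_dilation/even_Ber.
(* The dilation contributes the factor [Ber G], and [Ber G * Ber H = Ber (G *m H) = 1]. *)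
by rewrite det_dilation superalg_det1 inverse1 mul1r -Ber_mul // GH Ber1.
Qed.

Lemma all_entries_normalized : all_entries (D *m H *m coord).
Proof.
rewrite -mulmxA; apply: all_entries_mul all_entries_HA => i j.
rewrite -(splitK i) -(splitK j); case: (split i) => a; case: (split j) => b /=.
- by rewrite block_mxEul !mxE; case: (b == _); case: (a == _).
- by rewrite block_mxEur mxE.
- by rewrite block_mxEdl mxE.
- by rewrite block_mxEdr; apply: all_entries1.
Qed.

Lemma normalizer_mul (W : 'M[O]_(r + s)) :
  D *m W = block_mx (dilation (Ordinal r0) (Ber G) *m ulsubmx W)
    (dilation (Ordinal r0) (Ber G) *m ursubmx W) (dlsubmx W) (drsubmx W).
Proof. by rewrite -{1}[W]submxK mulmx_block !mul0mx !mul1mx !addr0 !add0r. Qed.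

(** Let [B] consist of the even columns [I] and the odd columns of [G]. Then [D H B] has upper right
    block 0 and lower right block 1, so the minor equals [Ber (D H B) = Ber B], whose inverse is the
    generator [Berstar B]. *)
Lemma normalized_minorX (I : increasing r p) :
  S (inverse (\det (colsub (sval I) (ulsubmx (D *m H *m coord))))).
Proof.
pose B := select_cols (even_cols q I) (odd_cols p J0) coord.
have uB : supermx_unit B by apply: Mtilde_select_unit (coord_Mtilde _ _ _ _ _).
have uDH := SL_unit normalizer_SL; have [_ _ BerDH] := normalizer_SL.
have [W2 W4] : ursubmx (H *m B) = 0 /\ drsubmx (H *m B) = 1%:M.
  have [] := @right_blocks _ _ _ _ _ (H *m B) (1%:M).
    by rewrite -HG !mulmx_select !row_mxKr.
  by rewrite scalar_mx_block block_mxKur block_mxKdr.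
have -> : colsub (sval I) (ulsubmx (D *m H *m coord)) = ulsubmx (D *m H *m B).
  by rewrite mulmx_select ulsubmx_select.
rewrite -Ber_ul; first last.
- by rewrite -mulmxA normalizer_mul block_mxKdr.
- by rewrite -mulmxA normalizer_mul block_mxKur W2 mulmx0.
rewrite (Ber_mul uDH uB) BerDH mul1r (inverseE (Ber_is_inverse uB)).
exact/minS/minor_star.
Qed.

(** Now [B] keeps the even columns of [G], so [D H B] has lower left block 0 and its upper left
    block is the dilation, of determinant [Ber G]. Comparing [Berstar (D H B) = Berstar B] with the
    block formula gives the minor [Ber G * Berstar B], with inverse [Ber B * Berstar G]. *)
Lemma normalized_minorY (J : increasing s q) :
  S (inverse (\det (colsub (sval J) (drsubmx (D *m H *m coord))))).
Proof.
pose B := select_cols (even_cols q I0) (odd_cols p J) coord.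
have uB : supermx_unit B by apply: Mtilde_select_unit (coord_Mtilde _ _ _ _ _).
have uDH := SL_unit normalizer_SL; have [_ _ BerDH] := normalizer_SL.
have [W1 W3] : ulsubmx (H *m B) = 1%:M /\ dlsubmx (H *m B) = 0.
  have [] := @left_blocks _ _ _ _ _ (H *m B) (1%:M).
    by rewrite -HG !mulmx_select !row_mxKl.
  by rewrite scalar_mx_block block_mxKul block_mxKdl.
have -> : colsub (sval J) (drsubmx (D *m H *m coord)) = drsubmx (D *m H *m B).
  by rewrite mulmx_select drsubmx_select.
have [[_ _ _ e4] _ _] := supermx_unit_mul uDH uB.
have := Berstar_mul uDH uB BerDH.
have BE : D *m H *m B = D *m (H *m B) by rewrite mulmxA.
rewrite Berstar_dr; last by rewrite BE normalizer_mul block_mxKdl.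
have -> : ulsubmx (D *m H *m B) = dilation (Ordinal r0) (Ber G).
  by rewrite BE normalizer_mul block_mxKul W1 mulmx1.
rewrite det_dilation (inverseE BerG) => e.
have -> : inverse (\det (drsubmx (D *m H *m B))) = Ber B * Berstar G.
  have detE : \det (drsubmx (D *m H *m B)) = Ber G * Berstar B.
    by rewrite -e mulrA BerG.1 mul1r.
  apply/inverseE/even_is_inverse; first exact: grade_det.
  by rewrite detE mulrA -(mulrA (Ber G)) (Ber_is_inverse uB).2 mulr1 BerG.1.
by apply: SM SBerstar; apply/minS/minor.
Qed.

Lemma normalized_term t : S (feval (D *m H *m coord) t).
Proof.
have SX := all_entries_normalized.
elim: t => [g|||t IH|t IHt u IHu|t IHt u IHu|c t IH] /=.
- case: g => [i j|i j|i j|i j|I|J] /=; try by rewrite 2!mxE; apply: SX.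
  + exact: normalized_minorX.
  + exact: normalized_minorY.
- exact: S0.
- exact: S1.
- exact: SN.
- exact: SD.
- exact: SM.
- exact: SZ.
Qed.

Lemma invariant_in_subsuperalg f : SL_invariants k r s p q f -> S f.
Proof.
move=> inv_f; have hC := coord_Mtilde k r s p q.
have -> : f = Oeval coord f by rewrite /Oeval feval_coord Opi_repr.
by rewrite -(inv_f _ _ _ normalizer_SL hC); apply: normalized_term.
Qed.

End Generation.

Lemma SL_invariants_generated (k : numFieldType) (r s p q : nat) :
  (0 < r)%N -> (r <= p)%N -> (s <= q)%N ->
  SL_invariants k r s p q = generated_superalg (super_minors k r s p q).
Proof.
move=> r0 rp sq; apply/seteqP; split=> f; last first.
  apply: smallest_sub; first exact: SL_invariants_subsuperalg.
  exact: super_minors_invariant.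
move=> inv_f S [subS minS].
have uG := Mtilde_select_unit (initial rp) (initial sq) (coord_Mtilde k r s p q).
have [H [uH GH HG]] := supermx_unit_inverse uG.
exact: (invariant_in_subsuperalg r0 subS minS uH GH HG).
Qed.

Theorem theorem3p1 (R : realType) (r s p q : nat) :
  (0 < r)%N -> (0 < s)%N -> (r <= p)%N -> (s <= q)%N ->
  SL_invariants R r s p q = generated_superalg (super_minors R r s p q) /\
  SL_invariants R[i] r s p q = generated_superalg (super_minors R[i] r s p q).
Proof. by move=> r0 _ rp sq; split; apply: SL_invariants_generated. Qed.
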